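(* Let $(\lambda_n)_{n\geq 2}$ be a sequence of compositions with $\lambda_n$ a composition of $n$. If $U_{\lambda_n}$ converges in $\mathcal{U}^{(2)}$ to $U=(U_{\uparrow},U_{\downarrow})$, then for every composition $\mu$ (every vertex of $\mathcal{Z}$), $$K_{\mu}(\lambda_n)\longrightarrow p_{U}(\mu)\quad (n\to\infty).$$
   Context: A composition $\lambda$ of $n$ is a sequence $(\lambda_1,\dots,\lambda_r)$ of positive integers with $\sum\lambda_j=n$; its descent set is $D_\lambda=\{\lambda_1,\lambda_1+\lambda_2,\dots,\lambda_1+\dots+\lambda_{r-1}\}\subset[1,n-1]$. For a permutation $\sigma\in\mathfrak{S}_k$ (written as the word $\sigma(1)\cdots\sigma(k)$), $des(\sigma)=\{i:\sigma(i+1)<\sigma(i)\}$. The graded graph $\mathcal{Z}$ has as vertices of degree $n$ the compositions of $n$ (and the empty composition $\emptyset$ in degree 0, joined to $(1)$). For $\mu=(\mu_1,\dots,\mu_s)$, $\lambda=(\lambda_1,\dots,\lambda_r)$ with $|\lambda|=|\mu|+1$, there is an edge $\mu\nearrow\lambda$ iff either $r=s$ and $\lambda$ is obtained from $\mu$ by increasing exactly one part by one, or $r=s+1$ and there is $j$ with $\lambda_k=\mu_k$ for $k<j$, $\lambda_j+\lambda_{j+1}-1=\mu_j$, and $\lambda_{k+1}=\mu_k$ for $k>j$. Let $d(\mu,\lambda)$ be the number of paths $\mu=\nu_0\nearrow\nu_1\nearrow\cdots\nearrow\nu_m=\lambda$ (zero if $|\mu|>|\lambda|$), $d(\lambda)=d(\emptyset,\lambda)$,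 and the Martin kernel $K_\mu(\lambda)=d(\mu,\lambda)/d(\lambda)$. $\mathcal{U}^{(2)}$ is the set of pairs $(U_\uparrow,U_\downarrow)$ of disjoint open subsets of $]0,1[$, with metric $d((U_\uparrow,U_\downarrow),(V_\uparrow,V_\downarrow))=\max(d_{Haus}(U_\uparrow^c,V_\uparrow^c),d_{Haus}(U_\downarrow^c,V_\downarrow^c))$, complements taken in $[0,1]$ and $d_{Haus}$ the Hausdorff distance. Paintbox: for $U\in\mathcal{U}^{(2)}$ and $x_1,\dots,x_k\in[0,1]$, $\sigma_U(x_1,\dots,x_k)\in\mathfrak{S}_k$ is defined by: $\sigma^{-1}(i)<\sigma^{-1}(j)$ iff either ($x_i,x_j$ are not in a common connected component of $U_\uparrow$ or of $U_\downarrow$, and $x_i<x_j$), or ($x_i,x_j$ lie in the same component of $U_\uparrow$ and $i<j$), or ($x_i,x_j$ lie in the same component of $U_\downarrow$ and $j<i$). With $X_1,X_2,\dots$ i.i.d. uniform on $[0,1]$, set $\sigma_U(k)=\sigma_U(X_1,\dots,X_k)$. For a composition $\mu$ of $k$, $p_U(\mu)=\mathbb{P}(\sigma_U(k)=\sigma)$ for any $\sigma\in\mathfrak{S}_k$ with $des(\sigma)=D_\mu$ (this is known to depend only on $\mu$). For a composition $\lambda$ of $n\geq2$, let $I_s=[\frac{s-1}{n-1},\frac{s}{n-1}]$ for $1\le s\le n-1$ and $U_\lambda=(U_\uparrow(\lambda),U_\downarrow(\lambda))$ with $U_\uparrow(\lambda)=\mathrm{int}\bigcup_{s\notin D_\lambda}I_s$,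 $U_\downarrow(\lambda)=\mathrm{int}\bigcup_{s\in D_\lambda}I_s$. *)

(* Defs.v *)
From HB Require Import structures.
From mathcomp Require Import all_boot all_order all_algebra all_fingroup.
From mathcomp Require Import all_classical all_reals all_analysis.
Set Implicit Arguments. Unset Strict Implicit. Unset Printing Implicit Defensive.
Import Order.TTheory GRing.Theory Num.Theory.
Import numFieldNormedType.Exports.
Local Open Scope classical_set_scope.
Local Open Scope ring_scope.

Definition is_comp (n : nat) (mu : seq nat) : bool :=
  all (fun a => (0 < a)%N) mu && (sumn mu == n).

Definition Dcomp (mu : seq nat) : seq nat :=
  [seq sumn (take l mu) | l <- iota 1 (size mu).-1].

Fixpoint lists_len (l n : nat) : seq (seq nat) :=
  if l is l'.+1 then [seq i :: s | i <- iota 1 n, s <- lists_len l' n]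
  else [:: [::]].

(* all compositions of n (each has length <= n and parts <= n) *)
Definition comps (n : nat) : seq (seq nat) :=
  undup [seq s <- flatten [seq lists_len l n | l <- iota 0 n.+1] | sumn s == n].

Definition zedge (mu lam : seq nat) : bool :=
  [|| (mu == [::]) && (lam == [:: 1%N]),
      (size lam == size mu) &&
        [exists j : 'I_(size mu), lam == incr_nth mu j]
    | (size lam == (size mu).+1) && all (fun a => (0 < a)%N) lam &&
        [exists j : 'I_(size mu),
          [&& take j lam == take j mu,
              nth 0 lam j + nth 0 lam j.+1 == (nth 0 mu j).+1
            & drop j.+2 lam == drop j.+1 mu]]].

Fixpoint npaths (m : nat) (mu lam : seq nat) : nat :=
  if m is m'.+1 then
    \sum_(nu <- comps (sumn lam).-1) (zedge nu lam * npaths m' mu nu)%N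
  else (mu == lam : nat).

(* d(mu, lam): paths have length |lam| - |mu|; zero if |mu| > |lam| *)
Definition dZ (mu lam : seq nat) : nat := npaths (sumn lam - sumn mu) mu lam.

Definition martinK {R : realType} (mu lam : seq nat) : R :=
  (dZ mu lam)%:R / (dZ [::] lam)%:R.

Definition pword (k : nat) (s : 'S_k) : seq nat := [seq val (s p) | p <- enum 'I_k].

(* des(sigma) = { i in [1,k-1] : sigma(i+1) < sigma(i) } (1-based positions) *)
Definition pdes (k : nat) (s : 'S_k) : seq nat :=
  [seq i <- iota 1 k.-1 | (nth 0 (pword s) i < nth 0 (pword s) i.-1)%N].

Section U2.
Variable R : realType.

Definition compl01 (A : set R) : set R := `[0, 1] `\` A.

Definition dist_set (B : set R) (a : R) : R := inf [set `|a - b| | b in B].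

Definition hausdorff (A B : set R) : R :=
  Num.max (sup [set dist_set B a | a in A]) (sup [set dist_set A b | b in B]).

Definition dU2 (U V : set R * set R) : R :=
  Num.max (hausdorff (compl01 U.1) (compl01 V.1))
          (hausdorff (compl01 U.2) (compl01 V.2)).

Definition Iseg (n s : nat) : set R := `[(s.-1)%:R / (n.-1)%:R, s%:R / (n.-1)%:R].

Definition Ulam (lam : seq nat) : set R * set R :=
  let n := sumn lam in
  (interior (\bigcup_(s in [set s : nat | (1 <= s <= n.-1)%N /\ s \notin Dcomp lam])
               Iseg n s),
   interior (\bigcup_(s in [set s : nat | (1 <= s <= n.-1)%N /\ s \in Dcomp lam])
               Iseg n s)).

Definition samecomp (A : set R) (x y : R) : Prop := A x /\ connected_component A x y.

(* the event sigma_U(x_1,...,x_k) = sigma, for x = [:: x_1; ...; x_k] *)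
Definition paint_event (Uu Ud : set R) (k : nat) (s : 'S_k) : set (seq R) :=
  [set x | forall i j : 'I_k,
     let xi := nth 0 x i in let xj := nth 0 x j in
     ((s^-1)%g i < (s^-1)%g j)%N <->
     ( (~ (samecomp Uu xi xj \/ samecomp Ud xi xj) /\ xi < xj)
       \/ (samecomp Uu xi xj /\ (i < j)%N)
       \/ (samecomp Ud xi xj /\ (j < i)%N) )].

Fixpoint iter_int01 (k : nat) (f : seq R -> \bar R) : \bar R :=
  if k is k'.+1 then
    (\int[@lebesgue_measure R]_(t in `[(0%R:R), (1%R:R)]%classic) iter_int01 k' (fun s => f (t :: s)))%E
  else f [::].

(* P(sigma_U(X_1,...,X_k) = sigma), X_i i.i.d. uniform on [0,1] *)
Definition paint_prob (Uu Ud : set R) (k : nat) (s : 'S_k) : R :=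
  fine (iter_int01 k (fun x => (\1_(paint_event Uu Ud s) x)%:E)).

End U2.

(* Main.v *)
(** Let [W] be the set of permutations of [n] with descent set [D_lambda].  Counting
    paths by inserting the largest value, [K_mu(lambda)] is the probability that a
    uniform [w] in [W] shows the pattern [sigma] on its [k] smallest values.  Swapping
    two consecutive values that are not adjacent in [w] preserves descents, so the [k]
    values may be replaced by any other [k] values; take one uniformly from each of [k]
    consecutive blocks.

    If the descent word changes sign at position [c], then ignoring the sign there costs
    only a factor [n] (move the entry before the cut to the bottom or the top), and
    makes the set of values left of [c] a uniform [c]-subset.  Exponential tails of the
    hypergeometric law beat this factor: every block of values is spread over the
    positions left and right of [c] in proportion to their number.

    Cut [0,1] at finitely many points outside [Uu] and [Ud] into components of [Uu] or
    [Ud] and short intervals.  Such points are limits of sign changes, so the cells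
    containing the [k] values become independent and are chosen with probability equal
    to their length, while inside a component [w] is monotone.  Up to the event that two
    values share a short cell, this is the paintbox rule. *)
Require Import Defs.
From HB Require Import structures.
From mathcomp Require Import all_boot all_order all_algebra all_fingroup.
From mathcomp Require Import all_classical all_reals all_analysis measurable_realfun.
From mathcomp Require Import zify ring lra.
Set Implicit Arguments.
Unset Strict Implicit.
Unset Printing Implicit Defensive.
Import Order.TTheory GRing.Theory Num.Theory.

(** * Permutations by insertion of the largest value *)

Lemma sum_fibers (T I : eqType) (r : seq T) (s : seq I) (f : T -> I) (P : pred T) (c : I -> nat) :
  uniq s -> {in r, forall x, f x \in s} ->
  \sum_(x <- r | P x) c (f x) = \sum_(i <- s) c i * count (fun x => (f x == i) && P x) r.
Proof.
move=> us fs; under [RHS]eq_bigr do rewrite -sum1_count big_mkcond big_distrr.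
rewrite exchange_big /= big_mkcond; apply: eq_big_seq => x xr.
rewrite (bigD1_seq (f x)) ?fs //= eqxx big1 => [|i /negbTE fi].
  by case: (P x); rewrite ?muln0 ?muln1 addn0.
by rewrite eq_sym fi muln0.
Qed.

Lemma perm_map_selfmap (T : eqType) (s : seq T) (f : T -> T) :
  uniq s -> {in s &, injective f} -> {in s, forall x, f x \in s} -> perm_eq (map f s) s.
Proof.
move=> us fI fs; have ufs : uniq (map f s) by rewrite map_inj_in_uniq.
apply: uniq_perm => //; have [||//] := uniq_min_size ufs (s2 := s).
- by move=> _ /mapP[x xs ->]; exact: fs.
- by rewrite size_map.
Qed.

Lemma count_selfmap (T : eqType) (s : seq T) (f : T -> T) (p : pred T) :
  uniq s -> {in s &, injective f} -> {in s, forall x, f x \in s} ->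
  count p s = count (p \o f) s.
Proof. by move=> us fI fs; rewrite -(seq.permP (perm_map_selfmap us fI fs)) count_map. Qed.

Fixpoint insertions (T : Type) (x : T) (s : seq T) : seq (seq T) :=
  (x :: s) :: (if s is y :: s' then map (cons y) (insertions x s') else [::]).

Lemma insertionsP (T : eqType) (x : T) (s t : seq T) :
  reflect (exists l r, s = l ++ r /\ t = l ++ x :: r) (t \in insertions x s).
Proof.
elim: s t => [|y s IH] t /=.
  rewrite inE; apply: (iffP eqP) => [->|[[|? l] [r [//= <- ->]]]] //.
  by exists [::], [::].
rewrite inE; apply: (iffP orP) => [[/eqP ->|/mapP[u /IH[l [r [-> ->]]] ->]]|].
- by exists [::], (y :: s).
- by exists (y :: l), r.
case=> -[|z l] [r [/= E ->]]; first by rewrite -E eqxx; left.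
by case: E => -> sE; right; apply/map_f/IH; exists l, r.
Qed.

Lemma size_insertions (T : Type) (x : T) (s : seq T) : size (insertions x s) = (size s).+1.
Proof. by elim: s => //= y s IH; rewrite size_map IH. Qed.

Definition perms (n : nat) : seq (seq nat) := permutations (iota 0 n).

Lemma perms_uniq n w : w \in perms n -> uniq w.
Proof. by rewrite mem_permutations => /perm_uniq ->; rewrite iota_uniq. Qed.

Lemma perms_mem n w x : w \in perms n -> (x \in w) = (x < n).
Proof. by rewrite mem_permutations => /perm_mem ->; rewrite mem_iota. Qed.

Lemma perms_size n w : w \in perms n -> size w = n.
Proof. by rewrite mem_permutations => /perm_size ->; rewrite size_iota. Qed.

Lemma perms_nth_lt n w i : w \in perms n -> i < n -> nth 0 w i < n.
Proof. by move=> wP ni; rewrite -(perms_mem _ wP) mem_nth ?(perms_size wP). Qed.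

Lemma perms_map n f w : {in gtn n &, injective f} -> {in gtn n, forall y, f y < n} ->
  w \in perms n -> map f w \in perms n.
Proof.
rewrite !mem_permutations => fI fn /(perm_map f)/perm_trans; apply.
apply: perm_map_selfmap; first exact: iota_uniq.
- by move=> x y; rewrite !mem_iota; exact: fI.
- by move=> x; rewrite !mem_iota; exact: fn.
Qed.

Lemma perms_succ n : perm_eq (perms n.+1) (flatten [seq insertions n w | w <- perms n]).
Proof.
have iotaS l r : perm_eq (l ++ n :: r) (iota 0 n.+1) = perm_eq (l ++ r) (iota 0 n).
  rewrite -addn1 iotaD perm_sym perm_catC perm_sym /= add0n.
  by rewrite -cat1s perm_catCA perm_cons.
have sub : {subset perms n.+1 <= flatten [seq insertions n w | w <- perms n]}.
  move=> w wP; have nw : n \in w by rewrite (perms_mem _ wP).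
  case/splitPr: nw wP => l r; rewrite mem_permutations iotaS => lrP.
  apply/flatten_mapP; exists (l ++ r); first by rewrite mem_permutations.
  by apply/insertionsP; exists l, r.
have size_le : size (flatten [seq insertions n w | w <- perms n]) <= size (perms n.+1).
  rewrite size_permutations ?iota_uniq // size_iota factS size_flatten sumnE !big_map.
  rewrite (eq_big_seq (fun=> n.+1)) => [|w /perms_size wn]; last by rewrite size_insertions wn.
  by rewrite big_const_seq count_predT iter_addn_0 size_permutations ?iota_uniq // size_iota.
have uP := permutations_uniq (iota 0 n.+1).
have [_ mem_eq] := uniq_min_size uP sub size_le.
by apply: uniq_perm => //; exact: leq_size_uniq uP sub size_le.
Qed.

Lemma count_perms_succ n (P : pred (seq nat)) :
  count P (perms n.+1) = \sum_(w <- perms n) count P (insertions n w).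
Proof. by rewrite (seq.permP (perms_succ n)) count_flatten sumnE !big_map. Qed.

Definition descents (w : seq nat) : seq bool :=
  if w is a :: r then pairmap (fun x y => y < x) a r else [::].

Lemma size_descents w : size (descents w) = (size w).-1.
Proof. by case: w => //= a r; rewrite size_pairmap. Qed.

Lemma nth_descents w i : i.+1 < size w -> nth false (descents w) i = (nth 0 w i.+1 < nth 0 w i).
Proof. by case: w => // a r; rewrite ltnS => ir; rewrite /= (nth_pairmap 0). Qed.

Lemma eq_descentsP n w e : size w = n -> size e = n.-1 ->
  reflect (forall i, i.+1 < n -> (nth 0 w i.+1 < nth 0 w i) = nth false e i) (descents w == e).
Proof.
move=> sw se; apply: (iffP eqP) => [<- i im|agree]; first by rewrite nth_descents ?sw.
apply: (@eq_from_nth _ false); first by rewrite size_descents sw se.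
by move=> i; rewrite size_descents sw => im; rewrite nth_descents ?sw ?agree; lia.
Qed.

(* Through descent words, [zedge] becomes the covering relation of the subword order. *)
Definition covers (T : eqType) (s e : seq T) := (size e == (size s).+1) && subseq s e.

Lemma covers_cons (T : eqType) (x y : T) s e :
  covers (x :: s) (y :: e) = if x == y then covers s e else x :: s == e.
Proof.
rewrite /covers /= eqSS; case: (x == y) => //; apply/andP/eqP => [[/eqP se]|<-//].
by move=> /size_subseq_leqif/geq_leqif; rewrite se leqnn => /esym/eqP.
Qed.

Lemma count_descents_insertions n a r e : all (gtn n) (a :: r) ->
  count (fun w => descents w == e) (insertions n (a :: r)) = covers (descents (a :: r)) e.
Proof.
elim: r a e => [|b r IH] a e /= /andP[an rn].
  rewrite an ltnNge (ltnW an) addn0 /=.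
  by case: e => [|[] [|]].
have /andP[bn _] := rn.
case: e => [|y e]; first by rewrite !count_map /=; elim: (insertions n r).
have {IH} := IH b e rn; rewrite !count_map /= bn /= !eqseq_cons an (ltnNge n a) (ltnW an) /=.
rewrite covers_cons !count_map; set x := b < a; set s := pairmap _ b r => IH.
rewrite (eq_count (a2 := fun w => (x == y) && (descents (b :: w) == e))); last first.
  by move=> w; rewrite /= eqseq_cons.
by case: x y => -[] /=; rewrite ?count_pred0 -?IH ?addn0.
Qed.

(** * Compositions and descent words *)

Fixpoint comp_word (l : seq nat) : seq bool :=
  if l is a :: l' then
    nseq a.-1 false ++ (if l' is [::] then [::] else true :: comp_word l')
  else [::].

Fixpoint word_comp (s : seq bool) : seq nat :=
  if s is b :: s' then if b then 1 :: word_comp s' else incr_nth (word_comp s') 0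
  else [:: 1].

Lemma comp_wordK l : l != [::] -> all (fun a => 0 < a) l -> word_comp (comp_word l) = l.
Proof.
elim: l => [//|a l IH] _ /= /andP[a0 al].
have -> : word_comp (nseq a.-1 false ++ if l is [::] then [::] else true :: comp_word l) =
    iter a.-1 (incr_nth^~ 0) (1 :: l).
  have <- : word_comp (if l is [::] then [::] else true :: comp_word l) = 1 :: l.
    by case: l IH al => // b l IH bl; rewrite [LHS]/= IH.
  by elim: a.-1 => //= m ->.
by case: a a0 => // a _; elim: a => //= a ->.
Qed.

Lemma is_comp_word_comp s : is_comp (size s).+1 (word_comp s).
Proof.
rewrite /is_comp; elim: s => [|[] s] //=; rewrite ?add1n ?eqSS //.
by case: (word_comp s) => //= a l /andP[/andP[_ ->] /eqP <-]; rewrite addSn eqxx.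
Qed.

Lemma word_comp_neq0 s : word_comp s != [::].
Proof. by case: s => [|[] s] //=; case: (word_comp s). Qed.

Lemma word_compK s : comp_word (word_comp s) = s.
Proof.
elim: s => [|b s IH] //=; have /andP[+ _] := is_comp_word_comp s.
by case: (word_comp s) (word_comp_neq0 s) IH => // -[|a] l _ <-; case: b.
Qed.

Lemma is_comp_neq0 n l : is_comp n.+1 l -> l != [::].
Proof. by case: l. Qed.

Lemma is_comp0 l : is_comp 0 l -> l = [::].
Proof. by case: l => // -[|a] l /andP[]. Qed.

Lemma comp_word_inj n l l' : is_comp n l -> is_comp n l' -> comp_word l = comp_word l' -> l = l'.
Proof.
case: n => [/is_comp0 -> /is_comp0 -> //|n] cl cl' E.
have [/andP[al _] /andP[al' _]] := (cl, cl').
by rewrite -[l]comp_wordK ?(is_comp_neq0 cl) // E comp_wordK ?(is_comp_neq0 cl').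
Qed.

Lemma size_comp_word n l : is_comp n l -> size (comp_word l) = n.-1.
Proof.
case: n => [/is_comp0 -> //|n cl]; have [al /eqP sl] := andP cl.
have := is_comp_word_comp (comp_word l); rewrite comp_wordK ?(is_comp_neq0 cl) // => /andP[_].
by rewrite sl eqSS => /eqP <-.
Qed.

Lemma Dcomp_cons a b l : Dcomp [:: a, b & l] = a :: map (addn a) (Dcomp (b :: l)).
Proof.
by rewrite /Dcomp /= addn0 -[2]/(1 + 1) iotaDl -!map_comp.
Qed.

Lemma mem_Dcomp n l x : is_comp n l ->
  (x \in Dcomp l) = (0 < x) && nth false (comp_word l) x.-1.
Proof.
move=> /andP[al _]; elim: l al x => [|a [|b l] IH] // al x.
- by rewrite nth_nil andbF.
- by rewrite /= cats0 nth_nseq if_same andbF.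
have [a0 bl] := andP al.
have -> : (x \in Dcomp [:: a, b & l]) = (x == a) || (a <= x) && (x - a \in Dcomp (b :: l)).
  rewrite Dcomp_cons inE; congr (_ || _).
  apply/mapP/andP => [[y yD ->]|[ax xD]]; first by rewrite leq_addr addKn.
  by exists (x - a); rewrite ?subnKC.
rewrite IH // [comp_word [:: a, b & l]]/= -/(comp_word (b :: l)) nth_cat nth_nseq size_nseq.
case: (ltngtP x a) => [xa|ax|->] /=; last by rewrite a0 ltnn subnn.
  by case: x xa => // x xa; rewrite (_ : x < a.-1) //; lia.
have [ax' x_gt0] : a.-1 <= x.-1 /\ 0 < x by lia.
rewrite subn_gt0 ax x_gt0 [x.-1 < _]ltnNge ax' /=.
by have -> : x.-1 - a.-1 = (x - a).-1.+1 by lia.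
Qed.

Definition comp_edge (mu lam : seq nat) : Prop := exists p a q, mu = p ++ a :: q /\
  (lam = p ++ a.+1 :: q \/
   exists x y, [/\ 0 < x, 0 < y, x + y = a.+1 & lam = p ++ [:: x, y & q]]).

Lemma incr_nth_cat p a q : incr_nth (p ++ a :: q) (size p) = p ++ a.+1 :: q.
Proof. by elim: p => //= b p ->. Qed.

Lemma zedgeP mu lam : mu != [::] -> all (fun a => 0 < a) lam ->
  reflect (comp_edge mu lam) (zedge mu lam).
Proof.
move=> /negbTE mu0 lam_gt0; rewrite /zedge mu0 lam_gt0 /= andbT.
have split_at j : j < size mu -> mu = take j mu ++ nth 0 mu j :: drop j.+1 mu.
  by move=> jm; rewrite -drop_nth // cat_take_drop.
apply: (iffP orP) => [|[p [a [q [-> ]]]]].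
  case=> /andP[/eqP sl /existsP[[j jm] /= lamP]];
    exists (take j mu), (nth 0 mu j), (drop j.+1 mu); split; [exact: split_at| |exact: split_at|].
    by left; rewrite -incr_nth_cat -split_at // size_takel ?(ltnW jm) //; apply/eqP.
  have jl : j.+1 < size lam by rewrite sl.
  have /and3P[/eqP <- /eqP <- /eqP <-] := lamP; right; exists (nth 0 lam j), (nth 0 lam j.+1).
  by rewrite -!drop_nth ?cat_take_drop ?(all_nthP 0 lam_gt0) // ltnW.
have jm : size p < size (p ++ a :: q) by rewrite size_cat /= addnS ltnS leq_addr.
case=> [->|[x [y [x0 y0 xy ->]]]].
  left; rewrite -incr_nth_cat size_incr_nth jm eqxx.
  by apply/existsP; exists (Ordinal jm).
right; apply/andP; split; first by rewrite !size_cat /= !addnS.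
apply/existsP; exists (Ordinal jm).
rewrite /= !take_size_cat // !nth_cat ltnn ltnNge leqnSn subnn subSnn eqxx /=.
apply/andP; split; first exact/eqP.
by rewrite -(cat1s a) -(cat1s x) -(cat1s y) !catA !drop_size_cat //; rewrite ?size_cat ?addn1.
Qed.

Lemma covers_cat (T : eqType) (p s e : seq T) : covers s e -> covers (p ++ s) (p ++ e).
Proof. by elim: p => //= x p IH /IH; rewrite covers_cons eqxx. Qed.

Lemma covers_behead (T : eqType) (x : T) s : covers s (x :: s).
Proof. by rewrite /covers subseq_cons /= eqxx. Qed.

Lemma comp_word_cat p q : q != [::] ->
  comp_word (p ++ q) = flatten [seq rcons (nseq a.-1 false) true | a <- p] ++ comp_word q.
Proof.
move=> q0; elim: p => //= a p IH; rewrite -catA -IH cat_rcons.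
by case: p q q0 {IH} => // -[].
Qed.

Lemma comp_edge_covers mu lam : all (fun a => 0 < a) mu -> comp_edge mu lam ->
  covers (comp_word mu) (comp_word lam).
Proof.
move=> mu_gt0 [p [a [q [muE lamE]]]]; move: mu_gt0; rewrite {mu}muE all_cat => /and3P[_ a0 _].
case: lamE => [|[x [y [x0 y0 xy]]]] ->; rewrite !comp_word_cat //; apply: covers_cat => /=.
  by case: a a0 => // a _; exact: covers_behead.
rewrite (_ : a.-1 = x.-1 + y.-1); last by lia.
by rewrite nseqD -catA; apply: covers_cat; exact: covers_behead.
Qed.

Lemma covers_comp_edge s e : covers s e -> comp_edge (word_comp s) (word_comp e).
Proof.
elim: e s => [|b e IH] s; first by rewrite /covers.
have wcE t : word_comp t = head 0 (word_comp t) :: behead (word_comp t).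
  by case: (word_comp t) (word_comp_neq0 t).
have edge_behead t : comp_edge (word_comp t) (word_comp (b :: t)).
  exists [::], (head 0 (word_comp t)), (behead (word_comp t)); rewrite /= -wcE; split => //.
  have /andP[+ _] := is_comp_word_comp t; rewrite [word_comp t]wcE => /andP[h0 _].
  by case: b; [right; exists 1, (head 0 (word_comp t)) | left].
case: s => [|x s]; first by case/andP => /eqP[/size0nil ->] _; exact: (edge_behead [::]).
rewrite covers_cons; case: eqP => [-> {x}|_ /eqP <-]; last exact: edge_behead.
move=> /IH[p [a [q [sE eE]]]] /=; case: b {IH edge_behead}.
  exists (1 :: p), a, q; rewrite sE; split => //.
  by case: eE => [|[x [y [x0 y0 xy]]]] ->; [left | right; exists x, y].
case: p sE eE => [|h p] sE eE.
  exists [::], a.+1, q; rewrite sE; split => //.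
  by case: eE => [|[x [y [x0 y0 xy]]]] ->; [left | right; exists x.+1, y; rewrite addSn xy].
exists (h.+1 :: p), a, q; rewrite sE; split => //.
by case: eE => [|[x [y [x0 y0 xy]]]] ->; [left | right; exists x, y].
Qed.

Lemma zedge_covers n mu lam : is_comp n.+1 mu -> is_comp n.+2 lam ->
  zedge mu lam = covers (comp_word mu) (comp_word lam).
Proof.
move=> cm cl; have [[m0 l0] [/andP[am _] /andP[al _]]] :=
  ((is_comp_neq0 cm, is_comp_neq0 cl), (cm, cl)).
apply/zedgeP/idP => // [|/covers_comp_edge]; first exact: comp_edge_covers.
by rewrite !comp_wordK.
Qed.

Lemma mem_lists_len l n s : (s \in lists_len l n) = (size s == l) && all (fun a => 0 < a <= n) s.
Proof.
elim: l s => [|l IH] [|a s] //=; first by apply/negbTE/negP => /allpairsP[[x y] [_ _]].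
rewrite eqSS; apply/allpairsP/idP => [[[x y] /= [xI yI [-> ->]]]|].
  by move: xI yI; rewrite mem_iota IH => xI /andP[-> ->]; rewrite !andbT.
move=> /and3P[sl an al]; exists (a, s); rewrite /= mem_iota IH sl al.
by split => //; move: an; rewrite add1n ltnS.
Qed.

Lemma mem_comps n s : (s \in comps n) = is_comp n s.
Proof.
rewrite mem_undup mem_filter /is_comp andbC.
case: eqP => [<-|_]; last by rewrite !andbF.
rewrite !andbT; apply/flatten_mapP/idP => [[l _]|al].
  by rewrite mem_lists_len => /andP[_]; apply: sub_all => a /andP[].
exists (size s); first by rewrite mem_iota ltnS /=; elim: s al => //= a s IH /andP[a0 /IH]; lia.
rewrite mem_lists_len eqxx /=.
elim: s al => //= a s IH /andP[a0 /IH le_sum]; rewrite a0 leq_addr /=.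
by apply: sub_all le_sum => b /andP[-> /leq_trans]; apply; exact: leq_addl.
Qed.

Definition descent_class (n : nat) (e : seq bool) : seq (seq nat) :=
  [seq w <- perms n | descents w == e].

Lemma mem_descent_class n e w : (w \in descent_class n e) = (w \in perms n) && (descents w == e).
Proof. by rewrite mem_filter andbC. Qed.

Lemma descent_classE n e w i : size e = n.-1 -> w \in descent_class n e -> i.+1 < n ->
  (nth 0 w i.+1 < nth 0 w i) = nth false e i.
Proof.
move=> se; rewrite mem_descent_class => /andP[/perms_size sw dw] im.
by have /(eq_descentsP sw se) := dw; apply.
Qed.

Definition descent_comp (w : seq nat) : seq nat :=
  if w is [::] then [::] else word_comp (descents w).

Lemma is_comp_descent_comp n w : w \in perms n -> is_comp n (descent_comp w).
Proof.
move=> /perms_size <-; case: w => // a w.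
by have := is_comp_word_comp (descents (a :: w)); rewrite size_descents.
Qed.

Lemma descents_comp_word n w nu : w \in perms n -> is_comp n nu ->
  (descents w == comp_word nu) = (descent_comp w == nu).
Proof.
move=> wP cn; have <- : comp_word (descent_comp w) = descents w.
  by case: w {wP} => // a w; rewrite word_compK.
apply/eqP/eqP => [|-> //].
exact: comp_word_inj (is_comp_descent_comp wP) cn.
Qed.

Lemma count_insertions_zedge n w lam : w \in perms n -> is_comp n.+1 lam ->
  count (fun u => descents u == comp_word lam) (insertions n w) = zedge (descent_comp w) lam.
Proof.
case: n => [|n] wP cl; have := perms_size wP.
  move=> /size0nil ->; have -> // : lam = [:: 1].
  by apply: (comp_word_inj cl) => //; apply: size0nil; rewrite (size_comp_word cl).
case: w wP => // a r wP _; rewrite count_descents_insertions; last first.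
  by apply/allP => x; rewrite (perms_mem x wP).
by rewrite (zedge_covers (is_comp_descent_comp wP) cl) word_compK.
Qed.

Lemma count_descent_class_succ n lam (Q : pred (seq nat)) : is_comp n.+1 lam ->
  count (fun w => Q [seq x <- w | x < n]) (descent_class n.+1 (comp_word lam)) =
  \sum_(nu <- comps n) zedge nu lam * count Q (descent_class n (comp_word nu)).
Proof.
move=> cl; rewrite count_filter count_perms_succ.
transitivity (\sum_(w <- perms n | Q w) zedge (descent_comp w) lam).
  rewrite [RHS]big_mkcond; apply: eq_big_seq => w wP.
  rewrite (eq_in_count (a2 := fun u => Q w && (descents u == comp_word lam))).
    by case: (Q w); rewrite ?count_pred0 // count_insertions_zedge.
  move=> _ /insertionsP[l [r [wE ->]]]; rewrite /predI /= filter_cat /= ltnn -filter_cat -wE.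
  by congr (Q _ && _); apply/all_filterP/allP => x; rewrite (perms_mem x wP).
rewrite (sum_fibers _ (zedge^~ lam) (s := comps n) (undup_uniq _)); last first.
  by move=> w /is_comp_descent_comp; rewrite mem_comps.
apply: eq_big_seq => nu; rewrite mem_comps => cn; congr (_ * _); rewrite count_filter.
by apply: eq_in_count => w wP; rewrite /predI /= (descents_comp_word wP cn) andbC.
Qed.

Lemma npaths_count m k mu sg lam :
  is_comp k mu -> sg \in perms k -> descents sg = comp_word mu -> is_comp (m + k) lam ->
  npaths m mu lam =
  count (fun w => [seq x <- w | x < k] == sg) (descent_class (m + k) (comp_word lam)).
Proof.
move=> cm sgP sgE; elim: m lam => [|m IH] lam cl.
  rewrite add0n (eq_in_count (a2 := pred1 sg)) => [|w]; last first.
    rewrite mem_descent_class => /andP[wP _].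
    rewrite (_ : [seq x <- w | x < k] = w) //.
    by apply/all_filterP/allP => x; rewrite (perms_mem x wP).
  rewrite count_uniq_mem ?filter_uniq ?permutations_uniq // mem_descent_class sgP sgE.
  by congr nat_of_bool; apply/eqP/eqP => [->//|]; exact: comp_word_inj cm cl.
have -> : npaths m.+1 mu lam = \sum_(nu <- comps (m + k)) zedge nu lam * npaths m mu nu.
  by rewrite /= (_ : (sumn lam).-1 = m + k) //; case/andP: cl => _ /eqP ->.
transitivity (\sum_(nu <- comps (m + k)) zedge nu lam *
    count (fun w => [seq x <- w | x < k] == sg) (descent_class (m + k) (comp_word nu))).
  by apply: eq_big_seq => nu; rewrite mem_comps => /IH ->.
rewrite -(count_descent_class_succ (fun w => _ == sg) cl); apply: eq_count => w.
rewrite -filter_predI; congr (_ == _); apply: eq_filter => x /=.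
by case: (ltnP x k) => //= xk; rewrite (leq_trans xk) // leq_addl.
Qed.

(** * Combinations *)

Fixpoint combinations (T : Type) (k : nat) (s : seq T) : seq (seq T) :=
  match k, s with
  | 0, _ => [:: [::]]
  | k'.+1, [::] => [::]
  | k'.+1, x :: s' => [seq x :: v | v <- combinations k' s'] ++ combinations k s'
  end.

Lemma size_combinations (T : Type) k (s : seq T) : size (combinations k s) = 'C(size s, k).
Proof. by elim: s k => [|x s IH] [|k] //=; rewrite size_cat size_map !IH binS addnC. Qed.

Lemma mem_combinations (T : eqType) k (s v : seq T) :
  (v \in combinations k s) = subseq v s && (size v == k).
Proof.
elim: s k v => [|x s IH] [|k] [|y v]; rewrite ?sub0seq ?andbF //= mem_cat IH.
  by rewrite andbF orbF; apply/negP => /mapP[].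
case: (y =P x) => [->|yx]; last first.
  by rewrite (_ : _ \in _ = false) //; apply/negP => /mapP[u _ []].
rewrite mem_map ?IH => [|u u' []] //; rewrite eqSS.
by apply/orP/andP => [[/andP[]|/andP[/cons_subseq]]|vs] //; left; apply/andP.
Qed.

Lemma uniq_combinations (T : eqType) k (s : seq T) : uniq s -> uniq (combinations k s).
Proof.
elim: s k => [|x s IH] [|k] //= /andP[xs us].
rewrite cat_uniq map_inj_uniq ?IH // => [|u v []] //.
rewrite andbT /=; apply/hasPn => v; rewrite mem_combinations => /andP[/mem_subseq vs _].
by apply: contra xs => /mapP[u _ E]; apply: vs; rewrite E mem_head.
Qed.

Lemma count_combinations (T : eqType) (p : pred T) (s : seq T) i j :
  count (fun v => count p v == i) (combinations (i + j) s) =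
  'C(count p s, i) * 'C(count (predC p) s, j).
Proof.
elim: s i j => [|x s IH] i j; first by case: i j => [|i] [|j]; rewrite //= bin0n ?muln0.
case ijE : (i + j) => [|k].
  by move/eqP: ijE; rewrite addn_eq0 => /andP[/eqP -> /eqP ->]; rewrite !bin0.
rewrite [count p _]/= [count (predC p) _]/= count_cat count_map -ijE IH.
rewrite (eq_count (a2 := fun v => p x + count p v == i)) //.
case: (p x); rewrite /= ?add0n ?add1n.
  case: i ijE => [|i] ijE; first by rewrite count_pred0 !bin0.
  by have -> : k = i + j; [lia | rewrite IH binS mulnDl addnC].
case: j ijE => [|j] ijE; last by have -> : k = i + j; [lia | rewrite IH binS mulnDr addnC].
rewrite !bin0 -[RHS]add0n; congr (_ + _).
rewrite (eq_in_count (a2 := pred0)) ?count_pred0 // => v.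
by rewrite mem_combinations => /andP[_ /eqP vk]; have := count_size p v; rewrite /pred0 /=; lia.
Qed.

Lemma sorted_ltn_uniq s : sorted ltn s -> uniq s.
Proof. exact: sorted_uniq ltn_trans ltnn s. Qed.

Lemma mem_combinations_iota n k v :
  (v \in combinations k (iota 0 n)) = [&& sorted ltn v, all (gtn n) v & size v == k].
Proof.
rewrite mem_combinations andbA; congr (_ && _); apply/idP/andP => [vn|[sv /allP vn]].
  split; first exact: (subseq_sorted ltn_trans vn (iota_ltn_sorted 0 n)).
  by apply/allP => x /(mem_subseq vn); rewrite mem_iota.
rewrite (_ : v = [seq x <- iota 0 n | x \in v]) ?filter_subseq //.
apply: (irr_sorted_eq ltn_trans ltnn sv).
  by apply: sorted_filter (iota_ltn_sorted 0 n); exact: ltn_trans.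
by move=> x; rewrite mem_filter mem_iota; case xv: (x \in v) => //; have /= -> := vn x xv.
Qed.

(** * Exchangeability of values *)

Definition swapS (x y : nat) : nat :=
  if y == x then x.+1 else if y == x.+1 then x else y.

Lemma swapSK x : involutive (swapS x).
Proof.
by move=> y; rewrite /swapS; case: (y =P x) => ?; [|case: (y =P x.+1) => ?];
  do 2 ?[case: eqP => ?]; lia.
Qed.

Lemma swapS_inj x : injective (swapS x).
Proof. exact: inv_inj (@swapSK x). Qed.

Lemma swapSl x : swapS x x = x.+1.
Proof. by rewrite /swapS eqxx. Qed.

Lemma swapSr x : swapS x x.+1 = x.
Proof. by rewrite /swapS eqxx gtn_eqF. Qed.

Lemma map_swapSK x : involutive (map (swapS x)).
Proof. by move=> w; rewrite mapK //; exact: swapSK. Qed.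

Lemma mem_map_swapS x v y : (y \in map (swapS x) v) = (swapS x y \in v).
Proof. by rewrite -{1}(swapSK x y) mem_map //; exact: swapS_inj. Qed.

Lemma swapS_lt x u v : ~~ ((u == x) && (v == x.+1)) -> ~~ ((u == x.+1) && (v == x)) ->
  (swapS x u < swapS x v) = (u < v).
Proof. by rewrite /swapS; do 4 ?[case: eqP => ?]; lia. Qed.

Lemma swapS_bound n x y : x.+1 < n -> y < n -> swapS x y < n.
Proof. by rewrite /swapS; do 2 ?[case: eqP => ?]; lia. Qed.

Lemma map_swapS_id x w : x \notin w -> x.+1 \notin w -> map (swapS x) w = w.
Proof.
move=> xw xSw; apply: map_id_in => y yw; rewrite /swapS.
by case: eqP yw => [->|_]; [rewrite (negbTE xw) | case: eqP => // ->; rewrite (negbTE xSw)].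
Qed.

Lemma perms_swapS n x w : x.+1 < n -> w \in perms n -> map (swapS x) w \in perms n.
Proof.
by move=> xn; apply: perms_map => [y z _ _|y]; [exact: swapS_inj | exact: swapS_bound].
Qed.

Definition adjacent (x : nat) (w : seq nat) : bool :=
  infix [:: x; x.+1] w || infix [:: x.+1; x] w.

Lemma adjacent_map_swapS x w : adjacent x (map (swapS x) w) = adjacent x w.
Proof.
have inf u v : infix u v -> infix (map (swapS x) u) (map (swapS x) v).
  move=> /infixP[p [s ->]]; rewrite !map_cat; apply/infixP.
  by exists (map (swapS x) p), (map (swapS x) s).
have adj u : adjacent x u -> adjacent x (map (swapS x) u).
  by rewrite /adjacent => /orP[] /inf; rewrite /= swapSl swapSr => ->; rewrite ?orbT.
by apply/idP/idP => /adj; rewrite ?map_swapSK.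
Qed.

Lemma infix_nth2 (w : seq nat) i : i.+1 < size w -> infix [:: nth 0 w i; nth 0 w i.+1] w.
Proof.
move=> iw; apply/infixP; exists (take i w), (drop i.+2 w).
by rewrite -[LHS](cat_take_drop i) (drop_nth 0) ?(drop_nth 0 iw) // ltnW.
Qed.

Definition swap_values (x : nat) (w : seq nat) : seq nat :=
  if adjacent x w then w else map (swapS x) w.

Lemma swap_valuesK x : involutive (swap_values x).
Proof.
move=> w; rewrite /swap_values; case adj : (adjacent x w); first by rewrite adj.
by rewrite adjacent_map_swapS adj map_swapSK.
Qed.

Lemma descents_swap_values x w : descents (swap_values x w) = descents w.
Proof.
rewrite /swap_values; case: ifP => // /negbT; rewrite negb_or => /andP[up down].
apply/eqP/(eq_descentsP (n := size w)); rewrite ?size_map ?size_descents // => i iw.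
rewrite nth_descents // !(nth_map 0) //; last exact: ltnW.
by apply: swapS_lt; [move: down | move: up]; apply: contra => /andP[/eqP <- /eqP <-];
  exact: infix_nth2.
Qed.

Lemma descent_class_swap_values n e x w : x.+1 < n ->
  w \in descent_class n e -> swap_values x w \in descent_class n e.
Proof.
move=> xn; rewrite !mem_descent_class descents_swap_values => /andP[wP ->].
by rewrite andbT /swap_values; case: ifP => // _; exact: perms_swapS.
Qed.

Definition has_pattern (sg v w : seq nat) : bool :=
  [seq y <- w | y \in v] == [seq nth 0 v i | i <- sg].

Lemma filter_swap_values x v w : uniq w -> x \notin v -> x.+1 \in v ->
  [seq y <- swap_values x w | y \in map (swapS x) v] = map (swapS x) [seq y <- w | y \in v].
Proof.
move=> uw xv xSv; rewrite (eq_filter (mem_map_swapS x v)).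
rewrite (_ : map _ _ = [seq y <- map (swapS x) w | swapS x y \in v]); last first.
  by rewrite filter_map; congr map; apply: eq_filter => y; rewrite /= swapSK.
rewrite /swap_values; case: ifP => // /orP[] /infixP[l [r wE]]; move: uw; rewrite {w}wE;
  rewrite cat_uniq /= !inE !negb_or; case/and5P => _ /and3P[xl xl' _] /andP[_ xr] xr' _;
  by rewrite !map_cat !filter_cat /= !map_swapS_id // !(swapSl, swapSr) xSv (negbTE xv).
Qed.

Lemma has_pattern_swap sg v x w : uniq w -> all (gtn (size v)) sg -> x \notin v -> x.+1 \in v ->
  has_pattern sg (map (swapS x) v) (swap_values x w) = has_pattern sg v w.
Proof.
move=> uw sgv xv xSv; rewrite /has_pattern filter_swap_values //.
have -> : [seq nth 0 (map (swapS x) v) i | i <- sg] = map (swapS x) [seq nth 0 v i | i <- sg].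
  by rewrite -map_comp; apply/eq_in_map => i /(allP sgv) iv; rewrite /= (nth_map 0).
by apply/eqP/eqP => [|-> //]; exact: (inj_map (@swapS_inj x)).
Qed.

Lemma map_swapS_combinations n k v x : v \in combinations k (iota 0 n) ->
  x \notin v -> x.+1 \in v -> map (swapS x) v \in combinations k (iota 0 n).
Proof.
rewrite !mem_combinations_iota size_map => /and3P[sv vn ->] xv xSv; rewrite andbT.
apply/andP; split.
  rewrite sorted_map; apply: (sub_in_sorted (P := mem v)) sv => //.
  move=> a b av bv /= ab; rewrite swapS_lt //; apply/negP => /andP[/eqP aE /eqP bE].
    by rewrite -aE av in xv.
  by lia.
by apply/allP => _ /mapP[y yv ->]; apply: swapS_bound; exact: (allP vn).
Qed.

Lemma sumn_map_swapS v x : uniq v -> x \notin v -> x.+1 \in v ->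
  (sumn (map (swapS x) v)).+1 = sumn v.
Proof.
move=> uv xv xSv; rewrite (perm_sumn (perm_to_rem xSv)).
rewrite (perm_sumn (perm_map _ (perm_to_rem xSv))) /= swapSr map_swapS_id //.
  by apply: contra xv; exact: mem_rem.
by rewrite mem_rem_uniq // inE eqxx.
Qed.

Lemma sorted_downclosed v : sorted ltn v -> (forall x, x.+1 \in v -> x \in v) ->
  v = iota 0 (size v).
Proof.
move=> sv dv; have uv := sorted_ltn_uniq sv.
have below x y : y \in v -> x <= y -> x \in v.
  move=> yv /subnKC yE; move: yv; rewrite -yE.
  by elim: (y - x) => [|d IH]; rewrite ?addn0 ?addnS // => /dv.
have sub : {subset v <= iota 0 (size v)}.
  move=> y yv; rewrite mem_iota /= add0n -(size_iota 0 y.+1).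
  by apply: uniq_leq_size (iota_uniq _ _) _ => x; rewrite mem_iota ltnS => /below; exact.
apply: (irr_sorted_eq ltn_trans ltnn sv (iota_ltn_sorted _ _)).
by have [] := uniq_min_size uv sub; rewrite ?size_iota.
Qed.

(* Descent on the sum of the values: replacing [x.+1] by a missing [x] ends at [iota 0 k]. *)
Lemma swap_invariant_const (T : Type) n k (g : seq nat -> T) :
  (forall v x, v \in combinations k (iota 0 n) -> x \notin v -> x.+1 \in v ->
     g (map (swapS x) v) = g v) ->
  forall v, v \in combinations k (iota 0 n) -> g v = g (iota 0 k).
Proof.
move=> gi v; have [b vb] := ubnP (sumn v); elim: b v vb => // b IH v vb vC.
have := vC; rewrite mem_combinations_iota => /and3P[sv _ /eqP vk].
have [/hasP[[|x] xSv xv]|/hasPn dv] := boolP (has (fun y => (0 < y) && (y.-1 \notin v)) v) => //.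
  rewrite -(gi v x) //; apply: IH; last exact: map_swapS_combinations.
  by rewrite -ltnS (sumn_map_swapS (sorted_ltn_uniq sv)).
rewrite {1}(sorted_downclosed sv) ?vk // => x /dv.
by rewrite /= negbK.
Qed.

Lemma count_has_pattern_const n k e sg v : sg \in perms k -> v \in combinations k (iota 0 n) ->
  count (has_pattern sg v) (descent_class n e) =
  count (has_pattern sg (iota 0 k)) (descent_class n e).
Proof.
move=> sgP; move: v; apply: swap_invariant_const => v x vC xv xSv.
move: vC; rewrite mem_combinations_iota => /and3P[_ vn /eqP vk].
have xn : x.+1 < n by exact: (allP vn).
rewrite (count_selfmap (f := swap_values x)) ?filter_uniq ?permutations_uniq //; first last.
- by move=> w; exact: descent_class_swap_values.
- by apply: in2W; exact: inv_inj (@swap_valuesK x).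
apply: eq_in_count => w; rewrite mem_descent_class => /andP[/perms_uniq uw _].
by rewrite /= has_pattern_swap // vk; apply/allP => i; rewrite (perms_mem _ sgP).
Qed.

(** * Cutting at a sign change *)

(* The cut lies between the first [c] entries and the others, at index [c.-1] of the
   descent word. *)
Definition cut_class (n c : nat) (e : seq bool) : seq (seq nat) :=
  [seq w <- perms n | all (fun i => (i == c.-1) || ((nth 0 w i.+1 < nth 0 w i) == nth false e i))
                          (iota 0 n.-1)].

Lemma mem_cut_class n c e w : w \in perms n ->
  reflect (forall i, i.+1 < n -> i != c.-1 -> (nth 0 w i.+1 < nth 0 w i) = nth false e i)
          (w \in cut_class n c e).
Proof.
move=> wP; rewrite mem_filter wP andbT; apply: (iffP allP) => [agree i im ic|agree i].
  by have := agree i; rewrite mem_iota (negbTE ic) => /(_ _)/eqP; apply; lia.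
by rewrite mem_iota => im; case: eqP => //= /eqP ic; apply/eqP/agree => //; lia.
Qed.

Lemma descent_class_sub_cut n c e : size e = n.-1 -> {subset descent_class n e <= cut_class n c e}.
Proof.
move=> se w wE; have := wE; rewrite mem_descent_class => /andP[wP _].
by apply/mem_cut_class => // i im _; exact: (descent_classE se wE).
Qed.

Lemma nth_mem_take (T : eqType) (x0 : T) (w : seq T) c i : uniq w -> i < size w ->
  (nth x0 w i \in take c w) = (i < c).
Proof. by move=> uw iw; rewrite in_take ?mem_nth // index_uniq. Qed.

Lemma cut_class_swapS n c e x w : w \in perms n -> x.+1 < n ->
  x \notin take c w -> x.+1 \in take c w ->
  (map (swapS x) w \in cut_class n c e) = (w \in cut_class n c e).
Proof.
move=> wP xn xt xSt; have [uw sw] := (perms_uniq wP, perms_size wP).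
have same i : i.+1 < n -> i != c.-1 ->
    (nth 0 (map (swapS x) w) i.+1 < nth 0 (map (swapS x) w) i) = (nth 0 w i.+1 < nth 0 w i).
  move=> im ic; have im' : i < n by exact: ltnW.
  rewrite !(nth_map 0) ?sw //; apply: swapS_lt; apply/negP => /andP[/eqP iE /eqP iSE];
    move: (nth_mem_take 0 c uw (i := i)) (nth_mem_take 0 c uw (i := i.+1));
    by rewrite iE iSE sw (negbTE xt) xSt => /(_ im') + /(_ im); lia.
apply/(mem_cut_class c e (perms_swapS xn wP))/(mem_cut_class c e wP) => agree i im ic.
  by rewrite -same // agree.
by rewrite same // agree.
Qed.

Lemma count_cut_class_const n c e v : v \in combinations c (iota 0 n) ->
  count (fun w => perm_eq (take c w) v) (cut_class n c e) =
  count (fun w => perm_eq (take c w) (iota 0 c)) (cut_class n c e).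
Proof.
move: v; apply: (swap_invariant_const (g := fun v => count (fun w => perm_eq (take c w) v) _)).
move=> v x vC xv xSv; rewrite !count_filter.
have xn : x.+1 < n.
  by move: vC; rewrite mem_combinations_iota => /and3P[_ /allP/(_ _ xSv)].
rewrite (count_selfmap (f := map (swapS x))) ?permutations_uniq //; first last.
- by move=> w; exact: perms_swapS.
- by apply: in2W; exact: inv_inj (@map_swapSK x).
apply: eq_in_count => w wP; rewrite /= -map_take.
have -> : perm_eq (map (swapS x) (take c w)) (map (swapS x) v) = perm_eq (take c w) v.
  by apply/idP/idP => [|/perm_map //]; apply: perm_map_inj; exact: swapS_inj.
case tv : (perm_eq _ _) => //.
have := @cut_class_swapS n c e x w wP xn; rewrite !(perm_mem tv) !mem_filter wP perms_swapS //.
by move=> /(_ xv xSv); rewrite !andbT.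
Qed.

Lemma count_cut n c e (p : pred nat) (T : pred nat) : c <= n ->
  count (fun w => T (count p (take c w))) (cut_class n c e) =
  count (fun w => perm_eq (take c w) (iota 0 c)) (cut_class n c e) *
  count (fun v => T (count p v)) (combinations c (iota 0 n)).
Proof.
move=> cn; pose left_values w := [seq y <- iota 0 n | y \in take c w].
have left_perm w : w \in perms n -> perm_eq (left_values w) (take c w).
  move=> wP; apply: uniq_perm; rewrite ?filter_uniq ?iota_uniq ?take_uniq ?(perms_uniq wP) //.
  move=> y; rewrite mem_filter mem_iota /= add0n -(perms_mem y wP).
  by case: (boolP (y \in take c w)) => // /mem_take ->.
have left_comb : {in cut_class n c e, forall w, left_values w \in combinations c (iota 0 n)}.
  move=> w; rewrite mem_filter => /andP[_ wP]; rewrite mem_combinations filter_subseq.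
  by rewrite (perm_size (left_perm w wP)) size_takel ?(perms_size wP) /=.
rewrite -sum1_count big_mkcond.
rewrite (eq_big_seq (fun w => T (count p (left_values w)) : nat)) => [|w]; last first.
  rewrite mem_filter => /andP[_ wP]; rewrite (seq.permP (left_perm w wP)).
  by case: (T _).
rewrite (sum_fibers predT (fun v => T (count p v) : nat) _ left_comb); last first.
  by rewrite uniq_combinations ?iota_uniq.
rewrite -[count _ (combinations _ _)]sum1_count big_distrr [RHS]big_mkcond /=.
apply: eq_big_seq => v vC; rewrite -(count_cut_class_const e vC) muln1.
rewrite (eq_in_count (a2 := fun w => perm_eq (take c w) v)) => [|w].
  by case: (T _); rewrite ?mul1n.
rewrite mem_filter => /andP[_ wP]; rewrite andbT; have lt := left_perm w wP.
apply/eqP/idP => [<-|tv]; first by rewrite perm_sym.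
have [sv _ _] := and3P (etrans (esym (mem_combinations_iota n c v)) vC).
apply: (irr_sorted_eq ltn_trans ltnn) => // [|y]; last by rewrite (perm_mem lt) (perm_mem tv).
by apply: sorted_filter (iota_ltn_sorted 0 n); exact: ltn_trans.
Qed.

Definition to_end (b : bool) (n a y : nat) : nat :=
  if b then (if y == a then n.-1 else if a < y then y.-1 else y)
  else (if y == a then 0 else if y < a then y.+1 else y).

Lemma to_end_inj b n a : a < n -> {in gtn n &, injective (to_end b n a)}.
Proof.
by move=> an y z; rewrite !inE /to_end => yn zn; case: b;
  do 2 ?[case: eqP => ?]; do 2 ?[case: ltnP => ?]; lia.
Qed.

Lemma to_end_bound b n a y : a < n -> y < n -> to_end b n a y < n.
Proof.
by rewrite /to_end => an yn; case: (ltngtP y a) => ?; case: b; lia.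
Qed.

Lemma to_end_mono b n a y z : y != a -> z != a -> (to_end b n a y < to_end b n a z) = (y < z).
Proof.
move=> /negbTE ya /negbTE za; rewrite /to_end ya za.
by case: b; [case: (ltnP a y); case: (ltnP a z) | case: (ltnP y a); case: (ltnP z a)]; lia.
Qed.

Lemma to_end_extreme b n a y : y < n -> a < n -> y != a ->
  (to_end b n a y < to_end b n a a) = b /\ (to_end b n a a < to_end b n a y) = ~~ b.
Proof.
move=> yn an ya; rewrite /to_end eqxx (negbTE ya).
by case: b; [case: (ltnP a y) | case: (ltnP y a)]; split; lia.
Qed.

(* The entry before the cut becomes the lowest or the highest value, which restores the
   descents on both sides of it because the signs there differ. *)
Lemma cut_class_to_end n c e w (a := nth 0 w c.-1) : 1 < c < n -> size e = n.-1 ->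
  nth false e c.-2 != nth false e c.-1 -> w \in cut_class n c e ->
  map (to_end (nth false e c.-1) n a) w \in descent_class n e.
Proof.
move=> /andP[c1 cn] se ec wC; have wP : w \in perms n by move: wC; rewrite mem_filter => /andP[].
have [uw sw] := (perms_uniq wP, perms_size wP); have an : a < n by apply: perms_nth_lt => //; lia.
rewrite mem_descent_class perms_map //; last 2 first.
- exact: to_end_inj.
- by move=> y; apply: to_end_bound.
set b := nth false e c.-1 in ec *.
apply/(eq_descentsP (n := n)); rewrite ?size_map // => i im.
have im' : i < n by exact: ltnW.
have na k : k < n -> (nth 0 w k == a) = (k == c.-1) by move=> kn; rewrite nth_uniq ?sw //; lia.
have extreme k : k < n -> k != c.-1 ->
    (to_end b n a (nth 0 w k) < to_end b n a a) = b /\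
    (to_end b n a a < to_end b n a (nth 0 w k)) = ~~ b.
  by move=> kn kc; apply: to_end_extreme => //; [exact: perms_nth_lt | rewrite na].
rewrite !(nth_map 0) ?sw //; have [i1|i1] := eqVneq i c.-1.
  have -> : nth 0 w i = a by rewrite i1.
  by rewrite (extreme i.+1 im _).1 ?i1 ?gtn_eqF.
have [i2|i2] := eqVneq i c.-2; last first.
  by rewrite to_end_mono ?na //; [exact: (mem_cut_class c e wP wC) | lia].
have -> : nth 0 w i.+1 = a by rewrite /a; congr nth; lia.
by rewrite (extreme i im' i1).2 i2; move: ec {extreme}; case: b; case: (nth _ _ _).
Qed.

Lemma size_cut_class n c e : 1 < c < n -> size e = n.-1 ->
  nth false e c.-2 != nth false e c.-1 -> size (cut_class n c e) <= n * size (descent_class n e).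
Proof.
move=> cc se ec; pose code w := (map (to_end (nth false e c.-1) n (nth 0 w c.-1)) w, nth 0 w c.-1).
have entry_lt w : w \in cut_class n c e -> nth 0 w c.-1 < n.
  by rewrite mem_filter => /andP[_ wP]; apply: perms_nth_lt => //; lia.
rewrite mulnC -[X in _ * X](size_iota 0 n) -(size_allpairs pair) -(size_map code).
apply: uniq_leq_size => [|_ /mapP[w wC ->]]; last first.
  by apply/allpairsP; exists (code w); rewrite mem_iota entry_lt // cut_class_to_end.
rewrite map_inj_in_uniq ?filter_uniq ?permutations_uniq // => w w' wC wC' [+ E].
rewrite -E; apply: (inj_in_map (to_end_inj (entry_lt w wC))).
all: by apply/allP => y; move: wC wC'; rewrite !mem_filter => /andP[_ wP] /andP[_ wP'];
  rewrite (perms_mem _ wP, perms_mem _ wP').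
Qed.

Lemma count_descent_class_cut n c e (p T : pred nat) : 1 < c < n -> size e = n.-1 ->
  nth false e c.-2 != nth false e c.-1 ->
  count (fun w => T (count p (take c w))) (descent_class n e) * 'C(n, c) <=
  n * size (descent_class n e) * count (fun v => T (count p v)) (combinations c (iota 0 n)).
Proof.
move=> cc se ec; have cn : c <= n by case/andP: cc => _ /ltnW.
have := count_cut e p predT cn; rewrite !count_predT size_combinations size_iota => size_cut.
apply: leq_trans (_ : count (fun w => T (count p (take c w))) (cut_class n c e) * 'C(n, c) <= _).
  rewrite leq_mul2r -!size_filter uniq_leq_size ?orbT ?filter_uniq ?permutations_uniq //.
  by move=> w; rewrite !(mem_filter (fun w => T _)) => /andP[-> /descent_class_sub_cut->].
rewrite (count_cut e p T cn) mulnAC -size_cut leq_mul2r.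
by rewrite size_cut_class ?orbT.
Qed.

(** * Hypergeometric tails *)

Section HypergeometricTail.
Variable R : realFieldType.
Local Open Scope ring_scope.
Implicit Types (a b i r t : nat) (d : R).

Lemma mul_bin_shift a b i r : (r < b)%N ->
  ('C(a, i.+1) * 'C(b, r) * (i.+1 * (b - r)) = 'C(a, i) * 'C(b, r.+1) * ((a - i) * r.+1))%N.
Proof.
move=> rb; have /esym b_step := mul_bin_left b r; have a_step := mul_bin_left a i.
transitivity ((i.+1 * 'C(a, i.+1)) * ((b - r) * 'C(b, r)))%N; first by ring.
by rewrite a_step b_step; ring.
Qed.

(* Among the subsets of size [i + r] of [a + b] points, having [i] of the [a] points is
   typical when [i * b = r * a]; beyond that the probabilities decay geometrically. *)
Lemma hypergeometric_ratio a b i r d : 0 <= d <= 1 ->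
  r.+1%:R * a%:R + d * (a + b)%:R ^+ 2 <= i%:R * b%:R ->
  ('C(a, i.+1) * 'C(b, r))%:R <= (1 - d) * ('C(a, i) * 'C(b, r.+1))%:R :> R.
Proof.
move=> /andP[d0 d1] typical; have rhs_ge0 : 0 <= (1 - d) * ('C(a, i) * 'C(b, r.+1))%:R :> R.
  by rewrite mulr_ge0 // subr_ge0.
have [ai|ia] := leqP a i; first by rewrite bin_small ?mul0n.
have [br|rb] := leqP b r.
  have : (i * b < r.+1 * a)%N.
    rewrite [(r.+1 * a)%N]mulnC (@leq_ltn_trans (a * r)) ?leq_mul ?(ltnW ia) //.
    by rewrite ltn_pmul2l ?(leq_ltn_trans _ ia).
  have : 0 <= d * (a + b)%:R ^+ 2 by rewrite mulr_ge0 ?exprn_ge0.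
  by rewrite -(ltr_nat R) !natrM; lra.
have denom_gt0 : 0 < (i.+1 * (b - r))%:R :> R by rewrite ltr0n muln_gt0 subn_gt0.
have denom_le : (i.+1 * (b - r))%:R <= (a + b)%:R ^+ 2 :> R.
  rewrite -natrX ler_nat expnS expn1 leq_mul // ?(leq_trans ia) ?leq_addr //.
  by rewrite (leq_trans (leq_subr _ _)) ?leq_addl.
have gap : ((a - i) * r.+1)%:R + d * (a + b)%:R ^+ 2 <= (i.+1 * (b - r))%:R :> R.
  have : 0 <= b%:R - r%:R :> R by rewrite subr_ge0 ler_nat ltnW.
  have : 0 <= i%:R :> R by [].
  by move: typical; rewrite !natrM (natrB _ (ltnW ia)) (natrB _ (ltnW rb)) -!natr1; nra.
rewrite -(ler_pM2r denom_gt0) -natrM (mul_bin_shift _ _ rb) natrM [leRHS]mulrAC [leRHS]mulrC.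
by rewrite ler_wpM2l // mulrBl mul1r; have := ler_wpM2l d0 denom_le; lra.
Qed.

Lemma hypergeometric_decay a b i r t d : 0 <= d <= 1 -> (0 < a + b)%N ->
  r%:R * a%:R + t%:R * (a + b)%:R + d * (a + b)%:R ^+ 2 <= i%:R * b%:R ->
  ('C(a, i) * 'C(b, r))%:R <= (1 - d) ^+ t * ('C(a + b, i + r))%:R :> R.
Proof.
move=> /[dup] d01 /andP[d0 d1] n0; elim: t i r => [|t IH] i r.
  rewrite expr0 mul1r ler_nat -binomial.Vandermonde => _.
  have ir : (i < (i + r).+1)%N by rewrite ltnS leq_addr.
  by rewrite (bigD1 (Ordinal ir)) //= addKn leq_addr.
have n_gt0 : 0 < (a + b)%:R :> R by rewrite ltr0n.
have ra_ge0 : 0 <= r%:R * a%:R :> R by rewrite mulr_ge0.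
have dn_ge0 : 0 <= d * (a + b)%:R ^+ 2 by rewrite mulr_ge0 ?exprn_ge0.
have tn_ge0 : 0 <= t%:R * (a + b)%:R :> R by rewrite mulr_ge0.
case: i => [|i]; rewrite -natr1 mulrDl mul1r => atypical.
  by exfalso; move: atypical; rewrite mul0r; lra.
rewrite addSnnS exprS -mulrA; apply: le_trans (hypergeometric_ratio d01 _) _.
  move: atypical; rewrite -!natr1 natrD; nra.
rewrite ler_wpM2l ?subr_ge0 //; apply: IH.
by move: atypical; rewrite -!natr1 natrD; nra.
Qed.

Lemma hypergeometric_tail a b i r t d : 0 <= d <= 1 -> (0 < a + b)%N -> t%:R <= d * (a + b)%:R ->
  2 * d * (a + b)%:R ^+ 2 <= `|i%:R * b%:R - r%:R * a%:R| ->
  ('C(a, i) * 'C(b, r))%:R <= (1 - d) ^+ t * ('C(a + b, i + r))%:R :> R.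
Proof.
move=> d01 n0 td; have tn : t%:R * (a + b)%:R <= d * (a + b)%:R ^+ 2.
  by rewrite expr2 mulrA ler_wpM2r.
rewrite ler_normr opprB => /orP[dev|dev]; first by apply: hypergeometric_decay => //; lra.
by rewrite mulnC (addnC a) (addnC i); apply: hypergeometric_decay; rewrite 1?(addnC b) //; lra.
Qed.

Lemma count_combinations_tail (T : eqType) (p : pred T) (s : seq T) c t d :
  (c <= size s)%N -> (0 < size s)%N -> 0 <= d <= 1 -> t%:R <= d * (size s)%:R ->
  (count (fun v => 2 * d * (size s)%:R ^+ 2 <=
      `|(count p v)%:R * (size s)%:R - c%:R * (count p s)%:R|) (combinations c s))%:R
  <= c.+1%:R * (1 - d) ^+ t * ('C(size s, c))%:R :> R.
Proof.
move=> cs s0 d01 td; have sE := count_predC p s.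
pose dev (i : nat) := 2 * d * (size s)%:R ^+ 2 <= `|i%:R * (size s)%:R - c%:R * (count p s)%:R|.
have bound_ge0 : 0 <= (1 - d) ^+ t * ('C(size s, c))%:R :> R.
  by rewrite mulr_ge0 // exprn_ge0 // subr_ge0; case/andP: d01.
have -> : count (fun v => dev (count p v)) (combinations c s) =
    (\sum_(i <- iota 0 c.+1) dev i * count (fun v => count p v == i) (combinations c s))%N.
  rewrite -sum1_count big_mkcond.
  rewrite (eq_bigr (fun v => dev (count p v) : nat)) => [|v _]; last by case: (dev _).
  rewrite (sum_fibers predT (fun i => dev i : nat) (iota_uniq 0 c.+1)) => [|v].
    by apply: eq_bigr => i _; congr (_ * _)%N; apply: eq_count => v; rewrite andbT.
  by rewrite mem_combinations mem_iota => /andP[_ /eqP <-]; rewrite ltnS count_size.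
rewrite natr_sum big_seq -mulrA mulr_natl.
apply: (@le_trans _ _ (\sum_(i <- iota 0 c.+1) (1 - d) ^+ t * ('C(size s, c))%:R)); last first.
  by rewrite big_const_seq count_predT size_iota iter_addr_0.
rewrite [leRHS]big_seq; apply: ler_sum => i; rewrite mem_iota ltnS => /= ic.
case dev_i : (dev i); rewrite ?mul0n // mul1n.
rewrite -{1}(subnKC ic) count_combinations -{2}(subnKC ic) -sE.
apply: hypergeometric_tail; rewrite ?sE //; apply: le_trans dev_i _.
by rewrite -sE natrD (natrB _ ic) le_eqVlt; apply/orP; left; apply/eqP; congr `|_|; ring.
Qed.

End HypergeometricTail.

(** * Averages over a descent class *)

Section Mean.
Variables (R : realFieldType) (T : eqType).
Local Open Scope ring_scope.
Implicit Types (s : seq T) (F G : T -> R) (P Q : pred T) (x : R).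

Definition mean s F : R := (\sum_(w <- s) F w) / (size s)%:R.

Definition proportion P s : R := mean s (fun w => (P w)%:R).

Lemma mean_le s F G : {in s, forall w, F w <= G w} -> mean s F <= mean s G.
Proof.
by move=> FG; rewrite ler_wpM2r ?invr_ge0 // [leLHS]big_seq [leRHS]big_seq; apply: ler_sum.
Qed.

Lemma meanD s F G : mean s (fun w => F w + G w) = mean s F + mean s G.
Proof. by rewrite /mean big_split mulrDl. Qed.

Lemma meanN s F : mean s (fun w => - F w) = - mean s F.
Proof. by rewrite /mean sumrN mulNr. Qed.

Lemma mean_cst s x : (0 < size s)%N -> mean s (fun=> x) = x.
Proof.
move=> s0; rewrite /mean big_const_seq count_predT iter_addr_0 -[x *+ _]mulr_natr mulfK //.
by rewrite pnatr_eq0 -lt0n.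
Qed.

Lemma proportionE P s : proportion P s = (count P s)%:R / (size s)%:R.
Proof.
rewrite /proportion /mean -sum1_count natr_sum [in RHS]big_mkcond; congr (_ / _).
by apply: eq_bigr => w _; case: (P w).
Qed.

Lemma proportion_le P s x : 0 <= x -> (count P s)%:R <= x * (size s)%:R -> proportion P s <= x.
Proof.
rewrite proportionE; case: (posnP (size s)) => [->|s0] x0 count_le; first by rewrite invr0 mulr0.
by rewrite ler_pdivrMr // ltr0n.
Qed.

Lemma eq_proportion P Q s : {in s, P =1 Q} -> proportion P s = proportion Q s.
Proof. by move=> PQ; rewrite !proportionE (eq_in_count PQ). Qed.

Lemma proportion_exists_le (I : finType) (P : I -> pred T) s :
  proportion (fun w => [exists i, P i w]) s <= \sum_i proportion (P i) s.
Proof.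
rewrite /proportion /mean -mulr_suml exchange_big ler_wpM2r ?invr_ge0 //.
apply: ler_sum => w _; case: existsP => [[i Piw]|_]; last by rewrite sumr_ge0.
by rewrite (bigD1 i) //= Piw lerDl sumr_ge0.
Qed.

Lemma mean_sandwich s F P (lo hi : R) : (0 < size s)%N ->
  {in s, forall w, lo - (P w)%:R <= F w <= hi + (P w)%:R} ->
  lo - proportion P s <= mean s F <= hi + proportion P s.
Proof.
move=> s0 Fs; apply/andP; split.
  by rewrite -(mean_cst lo s0) -meanN -meanD; apply: mean_le => w /Fs/andP[].
by rewrite -(mean_cst hi s0) -meanD; apply: mean_le => w /Fs/andP[].
Qed.

End Mean.

Section Concentration.
Variable R : realFieldType.
Local Open Scope ring_scope.
Implicit Types (p : pred nat) (d : R).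

Definition unbalanced d p c (w : seq nat) : bool :=
  2 * d * (size w)%:R ^+ 2 <= `|(count p (take c w))%:R * (size w)%:R - c%:R * (count p w)%:R|.

Definition cut_point (n : nat) (e : seq bool) (c : nat) : bool :=
  [|| c == 0, c == n | (1 < c < n)%N && (nth false e c.-2 != nth false e c.-1)]%N.

Lemma cut_point_concentration n c t p e d : cut_point n e c -> size e = n.-1 -> (0 < n)%N ->
  0 < d <= 1 -> t%:R <= d * n%:R ->
  proportion R (unbalanced d p c) (descent_class n e) <= n%:R * n.+1%:R * (1 - d) ^+ t.
Proof.
move=> ec se n0 /andP[d0 d1] td; have d01 : 0 <= d <= 1 by rewrite ltW.
have tail_ge0 : 0 <= (1 - d) ^+ t by rewrite exprn_ge0 // subr_ge0.
have rhs_ge0 : 0 <= n%:R * n.+1%:R * (1 - d) ^+ t by rewrite !mulr_ge0.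
have size_class w : w \in descent_class n e -> size w = n.
  by rewrite mem_descent_class => /andP[/perms_size].
have balanced : {in descent_class n e, forall w,
    (count p (take c w))%:R * (size w)%:R = c%:R * (count p w)%:R :> R} ->
    proportion R (unbalanced d p c) (descent_class n e) <= n%:R * n.+1%:R * (1 - d) ^+ t.
  move=> bal; rewrite (@eq_proportion _ _ _ pred0) => [|w wE].
    by rewrite proportionE count_pred0 mul0r.
  rewrite /unbalanced bal // subrr normr0 leNgt size_class //.
  by rewrite !mulr_gt0 ?exprn_gt0 ?ltr0n.
case/or3P: ec => [/eqP c0|/eqP cn|/andP[cc ec]].
- by apply: balanced => w _; rewrite c0 take0 !mul0r.
- by apply: balanced => w wE; rewrite cn -(size_class w wE) take_size mulrC.
pose j := count p (iota 0 n).
pose dev (i : nat) := 2 * d * n%:R ^+ 2 <= `|i%:R * n%:R - c%:R * j%:R|.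
rewrite (@eq_proportion _ _ _ (fun w => dev (count p (take c w)))) => [|w wE]; last first.
  have /seq.permP wp : perm_eq w (iota 0 n).
    by move: wE; rewrite mem_descent_class mem_permutations => /andP[].
  by rewrite /unbalanced (size_class w wE) wp.
apply: proportion_le => //; have cn : (c <= n)%N by lia.
rewrite -(ler_pM2r (_ : 0 < 'C(n, c)%:R)) ?ltr0n ?bin_gt0 //.
have := count_descent_class_cut p dev cc se ec; rewrite -(ler_nat R) !natrM => /le_trans; apply.
have := @count_combinations_tail R _ p (iota 0 n) c t d; rewrite size_iota -/j.
move=> /(_ cn n0 d01 td) tail.
apply: le_trans (ler_wpM2l _ tail) _; first by rewrite mulr_ge0.
rewrite [leLHS](_ : _ = n%:R * c.+1%:R * (1 - d) ^+ t * (size (descent_class n e))%:R *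
  ('C(n, c))%:R); last by ring.
by rewrite !ler_wpM2r // ler_wpM2l // ler_nat.
Qed.

End Concentration.

(** * Expectations under product laws *)

Section Expectation.
Variable R : realFieldType.
Local Open Scope ring_scope.
Implicit Types C : finType.

Fixpoint expect C k (l : nat -> C -> R) (h : seq C -> R) : R :=
  if k is k'.+1 then
    \sum_(a : C) l 0%N a * expect k' (fun i => l i.+1) (fun s => h (a :: s))
  else h [::].

Definition distributions C k (l : nat -> C -> R) : Prop :=
  forall i, (i < k)%N -> (forall a, 0 <= l i a) /\ \sum_a l i a = 1.

Definition supported C (l : nat -> C -> R) (s : seq C) : Prop :=
  forall a0 i, (i < size s)%N -> l i (nth a0 s i) != 0.

Section Theory.
Variable C : finType.
Implicit Types (k : nat) (l : nat -> C -> R) (h : seq C -> R).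

Lemma distributionsS k l : distributions k.+1 l -> distributions k (fun i => l i.+1).
Proof. by move=> pl i ik; apply: pl. Qed.

Lemma expect_le k l h h' : distributions k l ->
  (forall s, size s = k -> supported l s -> h s <= h' s) -> expect k l h <= expect k l h'.
Proof.
elim: k l h h' => [|k IH] l h h' pl hh /=; first exact: hh.
have [l0 _] := pl 0%N isT; apply: ler_sum => a _.
have [->|la] := eqVneq (l 0%N a) 0; first by rewrite !mul0r.
rewrite ler_wpM2l //; apply: IH => [|s sk ls]; first exact: distributionsS.
by apply: hh => [|a0 [|i]] //=; [rewrite sk | exact: ls].
Qed.

Lemma expect_sum k l (I : Type) (r : seq I) (F : I -> seq C -> R) :
  expect k l (fun s => \sum_(i <- r) F i s) = \sum_(i <- r) expect k l (F i).
Proof.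
elim: k l F => //= k IH l F; under eq_bigr do rewrite IH mulr_sumr.
exact: exchange_big.
Qed.

Lemma expectZ k l h x : expect k l (fun s => h s * x) = expect k l h * x.
Proof.
by elim: k l h => //= k IH l h; under eq_bigr do rewrite IH mulrA; rewrite mulr_suml.
Qed.

Lemma expectD k l h h' : expect k l (fun s => h s + h' s) = expect k l h + expect k l h'.
Proof.
elim: k l h h' => //= k IH l h h'.
by under eq_bigr do rewrite IH mulrDr; rewrite big_split.
Qed.

Lemma expect_cst k l x : distributions k l -> expect k l (fun=> x) = x.
Proof.
elim: k l => //= k IH l pl; under eq_bigr do rewrite (IH _ (distributionsS pl)).
by rewrite -mulr_suml (pl 0%N isT).2 mul1r.
Qed.

Lemma expect01 k l h : distributions k l -> (forall s, 0 <= h s <= 1) -> 0 <= expect k l h <= 1.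
Proof.
move=> pl h01; apply/andP; split; [rewrite -(expect_cst 0 pl) | rewrite -(expect_cst 1 pl)];
  by apply: expect_le => // s _ _; case/andP: (h01 s).
Qed.

Lemma expect_close k l l' h th : distributions k l -> distributions k l' ->
  (forall s, 0 <= h s <= 1) -> 0 <= th ->
  (forall i a, (i < k)%N -> `|l i a - l' i a| <= th) ->
  `|expect k l h - expect k l' h| <= k%:R * #|C|%:R * th.
Proof.
move=> + + + th0; elim: k l l' h => [|k IH] l l' h pl pl' h01 ll /=.
  by rewrite subrr normr0 !mul0r.
have [l'0 l'1] := pl' 0%N isT; have [pS pS'] := (distributionsS pl, distributionsS pl').
rewrite -sumrB (le_trans (ler_norm_sum _ _ _)) //.
apply: (@le_trans _ _ (\sum_(a : C) (th + l' 0%N a * (k%:R * #|C|%:R * th)))); last first.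
  by rewrite big_split /= sumr_const -mulr_suml l'1 -[th *+ _]mulr_natl -natr1; lra.
apply: ler_sum => a _; set A := expect k _ _; set B := expect k _ _.
have AB : `|A - B| <= k%:R * #|C|%:R * th by apply: IH => // i b ik; apply: ll.
have /andP[A0 A1] : 0 <= A <= 1 by apply: expect01.
rewrite (_ : _ - _ = (l 0%N a - l' 0%N a) * A + l' 0%N a * (A - B)); last by ring.
rewrite (le_trans (ler_normD _ _)) // !normrM (ger0_norm (l'0 a)) lerD ?ler_wpM2l //.
by rewrite (ger0_norm A0) -[leRHS]mulr1 ler_pM // ll.
Qed.

Lemma expect_mem k (l : C -> R) a : distributions k (fun=> l) ->
  expect k (fun=> l) (fun s => (a \in s)%:R) <= k%:R * l a.
Proof.
elim: k => [|k IH] pl /=; first by rewrite mul0r.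
have [[l0 l1] pk] := (pl 0%N isT, distributionsS pl).
apply: (@le_trans _ _ (\sum_b ((b == a)%:R * l b + l b * (k%:R * l a)))).
  apply: ler_sum => b _; rewrite [leRHS](_ : _ = l b * ((b == a)%:R + k%:R * l a)); last by ring.
  rewrite ler_wpM2l //.
  apply: (@le_trans _ _ ((b == a)%:R + expect k (fun=> l) (fun s => (a \in s)%:R))).
    rewrite -(expect_cst (b == a)%:R pk) -expectD expect_le // => s _ _.
    by rewrite inE eq_sym -natrD ler_nat; case: (b == a).
  by rewrite lerD2l IH.
rewrite big_split /= -mulr_suml l1 -natr1 mulrDl addrC mul1r lerD //.
by rewrite (bigD1 a) //= eqxx mul1r big1 ?addr0 // => b /negbTE ->; rewrite mul0r.
Qed.

End Theory.

Definition pushforward (C C' : finType) (f : C -> C') (l : nat -> C -> R) (i : nat) (b : C') : R :=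
  \sum_(a | f a == b) l i a.

Lemma distributions_pushforward (C C' : finType) (f : C -> C') k l :
  distributions k l -> distributions k (pushforward f l).
Proof.
move=> pl i /pl[l0 l1]; split=> [b|]; first by rewrite sumr_ge0.
by rewrite -l1 [RHS](partition_big f predT).
Qed.

Lemma expect_pushforward (C C' : finType) (f : C -> C') k l (h : seq C' -> R) :
  expect k l (fun s => h (map f s)) = expect k (pushforward f l) h.
Proof.
elim: k l h => //= k IH l h; under eq_bigr do rewrite (IH _ (fun s => h (f _ :: s))).
rewrite (partition_big f predT) //=; apply: eq_bigr => b _.
by rewrite /pushforward mulr_suml; apply: eq_bigr => a /eqP ->.
Qed.

End Expectation.

(** * Relative orders determined by cells *)

Section Cells.
Variables (N : nat) (ty : 'I_N -> option bool).
Implicit Types (al : seq (option 'I_N)) (sg : seq nat).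

(* [None] stands for positions in no cell; [ty a] is [Some false] on ascending cells,
   [Some true] on descending cells and [None] on cells without orientation. *)
Definition ambiguous (a : option 'I_N) al : bool :=
  if a is Some b then (ty b == None) && (a \in al) else true.

Fixpoint resolved al : bool :=
  if al is a :: al' then ~~ ambiguous a al' && resolved al' else true.

Definition precedes al (i j : nat) : bool :=
  match nth None al i, nth None al j with
  | Some a, Some b => (a < b) || (a == b) &&
      (match ty a with Some false => i < j | Some true => j < i | None => false end)
  | _, _ => false
  end.

Definition realizes sg al : bool :=
  all (fun i => all (fun j => (index i sg < index j sg) == precedes al i j)
                    (iota 0 (size sg))) (iota 0 (size sg)).

Lemma realizesP sg al :
  reflect (forall i j, i < size sg -> j < size sg ->
             (index i sg < index j sg) = precedes al i j) (realizes sg al).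
Proof.
apply: (iffP allP) => [agree i j ik jk|agree i].
  have /agree/allP/(_ j) : i \in iota 0 (size sg) by rewrite mem_iota.
  by rewrite mem_iota => /(_ jk)/eqP.
by rewrite mem_iota => ik; apply/allP => j; rewrite mem_iota => jk; apply/eqP/agree.
Qed.

Lemma resolved_nth al i : resolved al -> i < size al -> nth None al i != None.
Proof.
elim: al i => [//|a al IH] [|i] /= /andP[ca sa] il; last exact: IH.
by case: a ca.
Qed.

Lemma resolved_same_cell al i j a : resolved al -> i < size al -> j < size al -> i != j ->
  nth None al i = Some a -> nth None al j = Some a -> ty a != None.
Proof.
have lt al' i' j' : resolved al' -> i' < j' < size al' ->
    nth None al' i' = Some a -> nth None al' j' = Some a -> ty a != None.
  elim: al' i' j' => [|b al' IH] i' j'; first by rewrite andbF.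
  case: j' => [|j'] //= /andP[ca sa]; rewrite !ltnS; case: i' => [|i'] /=; last exact: IH.
  by move=> jl bE jE; move: ca; rewrite bE /= negb_and => /orP[//|]; rewrite -jE mem_nth.
move=> sa il jl; case: (ltngtP i j) => // [ij|ji] _ iE jE.
  by apply: (lt al i j) => //; rewrite ij.
by apply: (lt al j i) => //; rewrite ji.
Qed.

Lemma resolved_precedes al (r : nat -> nat -> Prop) :
  (forall i, ~ r i i) ->
  (forall i j a b, i < size al -> j < size al -> nth None al i = Some a ->
     nth None al j = Some b -> a < b -> r i j /\ ~ r j i) ->
  (forall i j a d, i < size al -> j < size al -> i != j -> nth None al i = Some a ->
     nth None al j = Some a -> ty a = Some d -> r i j <-> (if d then j < i else i < j)) ->
  resolved al -> forall i j, i < size al -> j < size al -> r i j <-> precedes al i j.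
Proof.
move=> rii r_lt r_eq al_res i j il jl; rewrite /precedes.
have [<- {j jl}|ij] := eqVneq i j.
  split=> [/rii|] //; case: (nth None al i) => // a; rewrite ltnn eqxx /=.
  by case: (ty a) => [[]|]; rewrite ?ltnn.
case iE : (nth None al i) (resolved_nth al_res il) => [a|] // _.
case jE : (nth None al j) (resolved_nth al_res jl) => [b|] // _.
have [ab|ba|/val_inj ab] := ltngtP a b.
- by have [rij _] := r_lt i j a b il jl iE jE ab.
- have [_ rij] := r_lt j i b a jl il jE iE ba.
  by rewrite (_ : (a == b) = false) //; apply/eqP => E; rewrite E ltnn in ba.
rewrite -ab eqxx /= in jE *; have := resolved_same_cell al_res il jl ij iE jE.
by case aE : (ty a) => [d|] // _; exact: (r_eq i j a d).
Qed.

Definition surely_realizes sg al : bool := resolved al && realizes sg al.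

Definition possibly_realizes sg al : bool := resolved al ==> realizes sg al.

Variable R : realFieldType.
Local Open Scope ring_scope.

Lemma expect_unresolved k (l : option 'I_N -> R) (d : R) :
  distributions k (fun=> l) -> l None = 0 -> 0 <= d -> (forall a, ty a = None -> l (Some a) <= d) ->
  expect k (fun=> l) (fun al => (~~ resolved al)%:R) <= k%:R ^+ 2 * d.
Proof.
move=> + lN d0 ld; elim: k => [|k IH] pl /=; first by rewrite expr0n mul0r.
have [[l0 l1] pk] := (pl 0%N isT, distributionsS pl).
apply: (@le_trans _ _ (\sum_a l a * (k%:R * d + k%:R ^+ 2 * d))); last first.
  rewrite -mulr_suml l1 mul1r -natr1; have : 0 <= k%:R * d :> R by rewrite mulr_ge0.
  by rewrite expr2; lra.
apply: ler_sum => -[a|] _; last by rewrite lN !mul0r.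
rewrite ler_wpM2l //.
apply: (@le_trans _ _ (expect k (fun=> l) (fun al => (ambiguous (Some a) al)%:R) +
    expect k (fun=> l) (fun al => (~~ resolved al)%:R))).
  rewrite -expectD; apply: expect_le => // s _ _.
  by rewrite negb_and negbK; case: ambiguous; case: resolved; rewrite /= ?addr0 ?add0r ?lerDl.
rewrite lerD ?IH //=; case: (eqVneq (ty a) None) => [aN|_].
  by rewrite (le_trans (expect_mem _ pk)) // ler_wpM2l ?ld.
by rewrite (expect_cst _ pk) mulr_ge0.
Qed.

Lemma expect_possibly_le k sg (l : option 'I_N -> R) (d : R) :
  distributions k (fun=> l) -> l None = 0 -> 0 <= d -> (forall a, ty a = None -> l (Some a) <= d) ->
  expect k (fun=> l) (fun al => (possibly_realizes sg al)%:R) <=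
  expect k (fun=> l) (fun al => (surely_realizes sg al)%:R) + k%:R ^+ 2 * d.
Proof.
move=> pl lN d0 ld; apply: (le_trans _ (lerD (lexx _) (expect_unresolved pl lN d0 ld))).
rewrite -expectD; apply: expect_le => // s _ _.
by rewrite /possibly_realizes /surely_realizes;
  case: resolved; case: realizes; rewrite /= ?addr0 ?add0r.
Qed.

End Cells.

(** * Comparison of patterns with cells *)

Section BlockLaw.
Variable R : realFieldType.
Local Open Scope ring_scope.

Definition in_block (m i y : nat) : bool := (i * m <= y < i.+1 * m)%N.

Lemma count_in_block n m i : (i.+1 * m <= n)%N -> count (in_block m i) (iota 0 n) = m.
Proof.
move=> imn; have imS : (i * m + m = i.+1 * m)%N by rewrite mulSn addnC.
rewrite -(subnKC imn) -{1}imS -addnA !iotaD !count_cat add0n.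
have -> : count (in_block m i) (iota (i * m) m) = m.
  rewrite -[RHS](size_iota (i * m) m); apply/eqP; rewrite -all_count.
  by apply/allP => y; rewrite mem_iota imS.
have zero (s : seq nat) : {in s, forall y, ~~ in_block m i y} -> count (in_block m i) s = 0%N.
  by move=> sN; apply/eqP; rewrite -leqn0 leqNgt -has_count; apply/hasPn.
by rewrite !zero ?addn0 // => y; rewrite mem_iota /in_block; lia.
Qed.

Definition block_law (n m i : nat) (y : 'I_n) : R := (in_block m i y)%:R / m%:R.

Lemma sum_block_law n m i (P : pred nat) :
  \sum_(y < n | P y) @block_law n m i y =
  (count (fun y => in_block m i y && P y) (iota 0 n))%:R / m%:R.
Proof.
rewrite /block_law -mulr_suml; congr (_ / _).
rewrite -[in RHS](subn0 n) -/(index_iota 0 n) -sum1_count natr_sum [RHS]big_mkcond big_mkord.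
by rewrite big_mkcond; apply: eq_bigr => y _; case: (in_block _ _ _); case: (P y).
Qed.

Lemma distributions_block_law n m k : (0 < m)%N -> (k * m <= n)%N ->
  distributions k (@block_law n m).
Proof.
move=> m0 kmn i ik; split=> [y|]; first by rewrite divr_ge0.
rewrite (sum_block_law _ _ _ predT) (eq_count (a2 := in_block m i)) => [|y]; last by rewrite andbT.
by rewrite count_in_block ?divff ?pnatr_eq0 -?lt0n // (leq_trans _ kmn) // leq_mul2r ik orbT.
Qed.

Lemma supported_block_law n m k (v : seq 'I_n) : size v = k -> supported (@block_law n m) v ->
  map val v \in combinations k (iota 0 n).
Proof.
move=> vk vs; have block i : (i < k)%N -> in_block m i (nth 0%N (map val v) i).
  move=> ik; have y0 : 'I_n by case: v vk vs ik => [<-|y].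
  have := vs y0 i; rewrite vk (nth_map y0) ?vk // => /(_ ik).
  by rewrite /block_law; case: (in_block _ _ _) => //; rewrite mul0r eqxx.
rewrite mem_combinations_iota size_map vk eqxx andbT; apply/andP; split.
  apply/(sortedP 0%N) => i; rewrite size_map vk => iv.
  have /andP[_ lo] := block i (ltnW iv); have /andP[hi _] := block i.+1 iv.
  exact: leq_trans lo hi.
by apply/allP => _ /mapP[y _ ->] /=.
Qed.

Lemma mean_expect (T : eqType) (s : seq T) (C : finType) k (l : nat -> C -> R)
    (F : T -> seq C -> R) :
  mean s (fun w => expect k l (F w)) = expect k l (fun v => mean s (F^~ v)).
Proof. by rewrite /mean -expect_sum -expectZ. Qed.

Lemma mean_block_pattern n m k e sg : (0 < m)%N -> (k * m <= n)%N -> sg \in perms k ->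
  mean (descent_class n e)
    (fun w => expect k (@block_law n m) (fun v => (has_pattern sg (map val v) w)%:R)) =
  proportion R (has_pattern sg (iota 0 k)) (descent_class n e).
Proof.
move=> m0 kmn sgP; have law := distributions_block_law m0 kmn; rewrite mean_expect.
have same v : size v = k -> supported (@block_law n m) v ->
    mean (descent_class n e) (fun w => (has_pattern sg (map val v) w)%:R) =
    proportion R (has_pattern sg (iota 0 k)) (descent_class n e).
  move=> vk vs; rewrite -/(proportion R _ _) !proportionE.
  by rewrite (count_has_pattern_const e sgP (supported_block_law vk vs)).
rewrite -[RHS](expect_cst _ law); apply/le_anti/andP.
by split; apply: expect_le => // v vk vs; rewrite (same v vk vs).
Qed.

End BlockLaw.

Lemma sorted_index (T : eqType) (w : seq T) :
  uniq w -> sorted (fun x y => index x w < index y w) w.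
Proof.
case: w => // x0 w uw; apply/(sortedP x0) => i iw.
by rewrite !index_uniq // ltnW.
Qed.

Lemma has_patternP k sg v w : uniq w -> uniq v -> {subset v <= w} ->
  sg \in perms k -> size v = k ->
  reflect (forall i j, i < k -> j < k ->
     (index i sg < index j sg) = (index (nth 0 v i) w < index (nth 0 v j) w))
    (has_pattern sg v w).
Proof.
move=> uw uv vw sgP vk; pose r x y := index x w < index y w.
have rt : transitive r by move=> y x z; exact: ltn_trans.
have ri : irreflexive r by move=> x; exact: ltnn.
have sgk i : (i \in sg) = (i < k) by rewrite (perms_mem _ sgP).
have filter_sorted : sorted r [seq y <- w | y \in v].
  by apply: sorted_filter => //; exact: sorted_index.
apply: (iffP eqP) => [pattern|same_order].
  have index_mono i j : i < k -> j < k -> index i sg < index j sg -> r (nth 0 v i) (nth 0 v j).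
    move=> ik jk ij; move: filter_sorted; rewrite pattern sorted_map => sg_sorted.
    apply: (sorted_ltn_index (leT := relpre (nth 0 v) r) _ sg_sorted) => //; rewrite ?sgk //.
    by move=> y x z; exact: rt.
  move=> i j ik jk; apply/idP/idP; first exact: index_mono.
  case: (ltngtP (index i sg) (index j sg)) => // [ji|/index_inj ->]; rewrite ?sgk ?ltnn //.
  by have := index_mono j i jk ik ji; rewrite /r; lia.
apply: (irr_sorted_eq rt ri filter_sorted).
  rewrite sorted_map; apply: (sub_in_sorted (P := gtn k)) (sorted_index (perms_uniq sgP)).
    by move=> i j ik jk /=; rewrite same_order.
  by apply/allP => i; rewrite sgk.
move=> y; rewrite mem_filter; apply/andP/mapP => [[yv _]|[i]].
  exists (index y v); last by rewrite nth_index.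
  by rewrite sgk -vk index_mem.
by rewrite sgk -vk => iv ->; rewrite mem_nth // vw ?mem_nth.
Qed.

Lemma monotone_run (w : seq nat) (d : bool) p p' : uniq w -> p < p' < size w ->
  (forall i, p <= i < p' -> (nth 0 w i.+1 < nth 0 w i) = d) -> (nth 0 w p' < nth 0 w p) = d.
Proof.
move=> uw; elim: p' => // p' IH /andP[pp pw] run.
have last_step : (nth 0 w p'.+1 < nth 0 w p') = d by apply: run; rewrite leqnn -ltnS pp.
have ne : nth 0 w p'.+1 != nth 0 w p' by rewrite nth_uniq // ?gtn_eqF // ltnW.
move: pp; rewrite ltnS leq_eqVlt => /orP[/eqP -> //|pp].
have {}IH : (nth 0 w p' < nth 0 w p) = d.
  by apply: IH => [|i /andP[pi ip]]; [rewrite pp ltnW | apply: run; rewrite pi ltnW].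
by case: d last_step IH {run}; lia.
Qed.

Section Sandwich.
Variables (R : realFieldType) (n m k : nat) (e : seq bool) (sg : seq nat).
Variables (N : nat) (ty : 'I_N -> option bool) (cpos : nat -> option 'I_N).
Hypotheses (m_gt0 : 0 < m) (km_le : k * m <= n) (sgP : sg \in perms k) (se : size e = n.-1).
Hypothesis cpos_lt : forall p p' a b, p < n -> p' < n ->
  cpos p = Some a -> cpos p' = Some b -> a < b -> p < p'.
Hypothesis cpos_run : forall p p' a d i, p <= i < p' -> p' < n ->
  cpos p = Some a -> cpos p' = Some a -> ty a = Some d -> nth false e i = d.

Definition value_cell (w : seq nat) (y : nat) : option 'I_N := cpos (index y w).

Lemma index_lt_precedes w v i j : w \in descent_class n e -> v \in combinations k (iota 0 n) ->
  resolved ty (map (value_cell w) v) -> i < k -> j < k ->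
  (index (nth 0 v i) w < index (nth 0 v j) w) = precedes ty (map (value_cell w) v) i j.
Proof.
move=> wE; rewrite mem_combinations_iota => /and3P[sv /allP vn /eqP vk] res ik jk.
have := wE; rewrite mem_descent_class => /andP[wP _].
have vw : {subset v <= w} by move=> y /vn; rewrite (perms_mem _ wP).
pose pos i := index (nth 0 v i) w.
have pos_lt p : p < k -> pos p < n.
  by rewrite -vk -(perms_size wP) index_mem => pv; rewrite vw ?mem_nth.
have cell_pos p a : p < k -> nth None (map (value_cell w) v) p = Some a -> cpos (pos p) = Some a.
  by move=> pk; rewrite (nth_map 0) ?vk.
have val_pos p : p < k -> nth 0 w (pos p) = nth 0 v p.
  by rewrite -vk => pv; rewrite nth_index ?vw ?mem_nth.
have val_lt p q : p < k -> q < k -> (nth 0 v p < nth 0 v q) = (p < q).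
  by rewrite -vk => pv qv; exact: (lt_sorted_ltn_nth 0 sv pv qv).
have run p q a d : p < k -> q < k -> cpos (pos p) = Some a -> cpos (pos q) = Some a ->
    ty a = Some d -> pos p < pos q -> (q < p) = d.
  move=> pk qk pE qE aE pq; rewrite -(val_lt q p qk pk) -!val_pos //.
  apply: monotone_run; rewrite ?(perms_uniq wP) ?(perms_size wP) ?pq ?pos_lt // => x pxq.
  rewrite (descent_classE se wE); first exact: cpos_run pxq (pos_lt q qk) pE qE aE.
  by case/andP: pxq => _ /leq_ltn_trans; apply; exact: pos_lt.
have prec : pos i < pos j <-> precedes ty (map (value_cell w) v) i j.
  apply: (resolved_precedes (r := fun i j => pos i < pos j)) => //; rewrite ?size_map ?vk //.
  - by move=> q; rewrite ltnn.
  - move=> p q a b pk qk /(cell_pos _ _ pk) pE /(cell_pos _ _ qk) qE ab.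
    have lt_pq := cpos_lt (pos_lt p pk) (pos_lt q qk) pE qE ab.
    by split=> //; apply/negP; rewrite -leqNgt ltnW.
  move=> p q a d pk qk pq /(cell_pos _ _ pk) pE /(cell_pos _ _ qk) qE aE.
  have := run p q a d pk qk pE qE aE; have := run q p a d qk pk qE pE aE.
  have : pos p != pos q.
    apply: contra pq => /eqP /(congr1 (nth 0 w)); rewrite !val_pos // => /eqP.
    by rewrite nth_uniq ?vk ?sorted_ltn_uniq.
  by case: d {aE} => /=; lia.
by apply/idP/idP => /prec.
Qed.

Lemma has_pattern_realizes w v : w \in descent_class n e -> v \in combinations k (iota 0 n) ->
  resolved ty (map (value_cell w) v) -> has_pattern sg v w = realizes ty sg (map (value_cell w) v).
Proof.
move=> wE vC res; have := vC; rewrite mem_combinations_iota => /and3P[sv /allP vn /eqP vk].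
have := wE; rewrite mem_descent_class => /andP[wP _].
have vw : {subset v <= w} by move=> y /vn; rewrite (perms_mem _ wP).
apply/(has_patternP (perms_uniq wP) (sorted_ltn_uniq sv) vw sgP vk)/realizesP;
  by rewrite (perms_size sgP) => order i j ik jk; rewrite order // (index_lt_precedes wE vC res).
Qed.

Local Open Scope ring_scope.

Definition block_freq (w : seq nat) : nat -> option 'I_N -> R :=
  pushforward (fun y : 'I_n => value_cell w y) (@block_law R n m).

Lemma expect_block_pattern w : w \in descent_class n e ->
  expect k (block_freq w) (fun al => (surely_realizes ty sg al)%:R) <=
  expect k (@block_law R n m) (fun v => (has_pattern sg (map val v) w)%:R) <=
  expect k (block_freq w) (fun al => (possibly_realizes ty sg al)%:R).
Proof.
move=> wE; have law := distributions_block_law R m_gt0 km_le.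
rewrite -!expect_pushforward; apply/andP; split; apply: expect_le => // v vk vs;
  have := has_pattern_realizes wE (supported_block_law vk vs); rewrite -map_comp;
  rewrite /surely_realizes /possibly_realizes ler_nat;
  by case: resolved => [/(_ isT) ->|_] /=; rewrite ?leq_b1.
Qed.

Lemma pattern_proportion_sandwich (l : option 'I_N -> R) (th : R) (bad : pred (seq nat)) :
  distributions k (fun=> l) -> 0 <= th -> (0 < size (descent_class n e))%N ->
  (forall w i a, w \in descent_class n e -> ~~ bad w -> (i < k)%N ->
     `|block_freq w i a - l a| <= th) ->
  expect k (fun=> l) (fun al => (surely_realizes ty sg al)%:R) - k%:R * N.+1%:R * th
    - proportion R bad (descent_class n e) <=
  proportion R (has_pattern sg (iota 0 k)) (descent_class n e) <=
  expect k (fun=> l) (fun al => (possibly_realizes ty sg al)%:R) + k%:R * N.+1%:R * th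
    + proportion R bad (descent_class n e).
Proof.
move=> pl th0 class0 close; have law := distributions_block_law R m_gt0 km_le.
rewrite -(mean_block_pattern R e m_gt0 km_le sgP).
have kt : 0 <= k%:R * N.+1%:R * th by rewrite !mulr_ge0.
apply: mean_sandwich => // w wE.
have bool01 (P : pred (seq (option 'I_N))) s : 0 <= ((P s)%:R : R) <= 1.
  by rewrite ler0n lern1 leq_b1.
have surely01 := expect01 pl (bool01 (surely_realizes ty sg)).
have possibly01 := expect01 pl (bool01 (possibly_realizes ty sg)).
have pattern01 : 0 <= expect k (@block_law R n m) (fun v => (has_pattern sg (map val v) w)%:R) <= 1.
  by apply: expect01 => // v; rewrite ler0n lern1 leq_b1.
case: (boolP (bad w)) => [_|good] /=; first by lra.
have freq := distributions_pushforward (fun y : 'I_n => value_cell w y) law.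
have dist P := expect_close freq pl (bool01 P) th0 (fun i a => close w i a wE good).
move: (dist (surely_realizes ty sg)) (dist (possibly_realizes ty sg)) (expect_block_pattern wE).
rewrite card_option card_ord !ler_distl; lra.
Qed.

End Sandwich.

(** * Frequencies of cells in blocks of values *)

Lemma count_index_nth n w (Q : nat -> pred nat) : w \in perms n ->
  count (fun y => Q y (index y w)) (iota 0 n) = count (fun p => Q (nth 0 w p) p) (iota 0 n).
Proof.
move=> wP; have [uw sw] := (perms_uniq wP, perms_size wP).
have /seq.permP <- : perm_eq w (iota 0 n) by rewrite -mem_permutations.
rewrite -{2}(mkseq_nth 0 w) sw count_map; apply: eq_in_count => p.
by rewrite mem_iota => pn; rewrite /= index_uniq ?sw.
Qed.

Lemma count_take_nth n w c (B : pred nat) : size w = n ->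
  count B (take c w) = count (fun p => B (nth 0 w p) && (p < c)) (iota 0 n).
Proof.
move=> sw; rewrite -{1}(mkseq_nth 0 w) sw -map_take count_map take_iota.
rewrite -{2}(subnKC (geq_minr c n)) iotaD count_cat [X in _ + X](_ : _ = 0) ?addn0.
  by apply: eq_in_count => p; rewrite mem_iota leq_min /= => /andP[-> _]; rewrite andbT.
apply/eqP; rewrite -leqn0 leqNgt -has_count; apply/hasPn => p; rewrite mem_iota => pI.
by rewrite negb_and -leqNgt; apply/orP; right; move: pI; rewrite minnE; lia.
Qed.

Lemma ratio_close (R : realFieldType) (between left right lo hi n m junk err : R) :
  (0 < n -> 0 < m -> `|between + left - right| <= junk ->
  `|left * n - lo * m| <= err -> `|right * n - hi * m| <= err ->
  `|between / m - (hi - lo) / n| <= junk / m + 2 * err / (n * m))%R.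
Proof.
move=> n0 m0 junk_le lo_close hi_close.
rewrite (_ : _ - _ = (between + left - right) / m +
  ((right * n - hi * m) - (left * n - lo * m)) / (n * m))%R; last by field; rewrite !gt_eqF.
rewrite (le_trans (ler_normD _ _)) // !normf_div (gtr0_norm m0) (gtr0_norm (mulr_gt0 n0 m0)).
rewrite lerD ?ler_pM2r ?invr_gt0 ?mulr_gt0 //.
by move: lo_close hi_close; rewrite !ler_distl; lra.
Qed.

Section Frequencies.
Variables (R : realFieldType) (n m N : nat) (cpos : nat -> option 'I_N) (c : nat -> nat).
Local Open Scope ring_scope.
Implicit Types (w : seq nat) (i : nat) (a : 'I_N).
Hypothesis cpos_cut : forall p a, (p < n)%N -> cpos p != None ->
  ((cpos p == Some a) + (p < c a) = (p < c a.+1))%N.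

Lemma ler_norm_count (T : eqType) (s : seq T) (A B C J : pred T) :
  {in s, forall x, `|(A x)%:R + (B x)%:R - (C x)%:R| <= (J x)%:R :> R} ->
  `|(count A s)%:R + (count B s)%:R - (count C s)%:R| <= (count J s)%:R :> R.
Proof.
have countE (P : pred T) : (count P s)%:R = \sum_(x <- s) (P x)%:R :> R.
  by rewrite -sum1_count natr_sum [LHS]big_mkcond; apply: eq_bigr => x _; case: (P x).
move=> close; rewrite !countE -big_split -sumrB (le_trans (ler_norm_sum _ _ _)) //.
by rewrite [leLHS]big_seq [leRHS]big_seq; apply: ler_sum.
Qed.

Lemma count_cell_cut w a (B : pred nat) : w \in perms n ->
  `|(count (fun y => B y && (value_cell cpos w y == Some a)) (iota 0 n))%:R +
    (count B (take (c a) w))%:R - (count B (take (c a.+1) w))%:R| <=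
  (count (fun p => cpos p == None) (iota 0 n))%:R :> R.
Proof.
move=> wP; rewrite (count_index_nth (fun y p => B y && (cpos p == Some a)) wP).
rewrite !(count_take_nth _ _ (perms_size wP)); apply: ler_norm_count => p; rewrite mem_iota => pn.
case: (B _) => /=; last by rewrite addr0 subr0 normr0.
have := cpos_cut a pn; case: (eqVneq (cpos p) None) => [-> _|_ /(_ isT) <-].
  by rewrite add0r; do 2!case: (p < _)%N; rewrite /= ?subrr ?subr0 ?sub0r ?normrN ?normr0 ?normr1.
by rewrite natrD subrr normr0.
Qed.

Definition some_unbalanced k (d : R) w : bool :=
  [exists ai : 'I_N.+1 * 'I_k, unbalanced d (in_block m ai.2) (c ai.1) w].

Lemma proportion_some_unbalanced k e (d : R) t : (0 < n)%N -> size e = n.-1 -> 0 < d <= 1 ->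
  t%:R <= d * n%:R -> (forall b : nat, (b <= N)%N -> cut_point n e (c b)) ->
  proportion R (some_unbalanced k d) (descent_class n e) <=
  N.+1%:R * k%:R * (n%:R * n.+1%:R * (1 - d) ^+ t).
Proof.
move=> n0 se d01 td ec; apply: (le_trans (proportion_exists_le _ _ _)).
apply: (@le_trans _ _ (\sum_(ai : 'I_N.+1 * 'I_k) n%:R * n.+1%:R * (1 - d) ^+ t)).
  apply: ler_sum => -[a i] _; apply: cut_point_concentration => //=.
  by apply: ec; rewrite -ltnS.
by rewrite sumr_const card_prod !card_ord -[leLHS]mulr_natl natrM.
Qed.

Lemma block_freq_close k e (l : option 'I_N -> R) (d junk rho : R) w i (a : option 'I_N) :
  (0 < m)%N -> (k * m <= n)%N -> w \in descent_class n e -> (i < k)%N ->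
  (count (fun p => cpos p == None) (iota 0 n))%:R <= junk ->
  l None = 0 -> (forall b : 'I_N, `|((c b.+1)%:R - (c b)%:R) / n%:R - l (Some b)| <= rho) ->
  0 <= rho -> 0 <= d -> ~~ some_unbalanced k d w ->
  `|block_freq R n m cpos w i a - l a| <= (4 * d * n%:R + junk) / m%:R + rho.
Proof.
move=> m0 kmn; rewrite mem_descent_class => /andP[wP _] ik few_junk lN l_close rho0 d0 bal.
have m_gt0 : 0 < m%:R :> R by rewrite ltr0n.
have imn : (i.+1 * m <= n)%N by apply: leq_trans kmn; rewrite leq_mul2r ik orbT.
have n_gt0 : 0 < n%:R :> R by rewrite ltr0n (leq_trans _ imn) // muln_gt0.
rewrite /block_freq /pushforward (sum_block_law _ _ _ _ (fun y => value_cell cpos w y == a)).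
case: a => [a|]; last first.
  rewrite lN subr0 ger0_norm ?divr_ge0 // -[leLHS]addr0 lerD // ler_pM2r ?invr_gt0 //.
  rewrite (count_index_nth (fun y p => in_block m i y && (cpos p == None)) wP).
  rewrite -[leLHS]add0r lerD ?mulr_ge0 ?(le_trans _ few_junk) // ler_nat.
  by apply: sub_count => p /andP[].
have balanced (b : 'I_N.+1) :
    `|(count (in_block m i) (take (c b) w))%:R * n%:R - (c b)%:R * m%:R| <= 2 * d * n%:R ^+ 2.
  move/existsPn: bal => /(_ (b, Ordinal ik)); rewrite /unbalanced -ltNge => /ltW.
  have /seq.permP -> : perm_eq w (iota 0 n) by rewrite -mem_permutations.
  by rewrite (perms_size wP) count_in_block.
have cell_cut := le_trans (count_cell_cut a (in_block m i) wP) few_junk.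
have := balanced (lift ord0 a); have := balanced (widen_ord (leqnSn N) a); rewrite lift0 /=.
move=> lo_balanced hi_balanced; apply: le_trans (ler_distD _ _ _) (lerD _ (l_close a)).
apply: (le_trans (ratio_close n_gt0 m_gt0 cell_cut lo_balanced hi_balanced)).
by rewrite le_eqVlt; apply/orP; left; apply/eqP; field; rewrite !gt_eqF.
Qed.

End Frequencies.

Import numFieldNormedType.Exports.
Local Open Scope classical_set_scope.
Local Open Scope ring_scope.

(** * Hausdorff distance and sign changes *)

Section HausdorffDistance.
Variable R : realType.
Implicit Types (A B : set R) (x y eta : R).

Definition near_set eta A B : Prop := forall a, A a -> exists2 b, B b & `|a - b| < eta.

Lemma near_set_sup eta A B : A `<=` `[0, 1] -> B `<=` `[0, 1] -> B !=set0 ->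
  sup [set dist_set B a | a in A] < eta -> near_set eta A B.
Proof.
move=> A01 B01 [b0 Bb0] sup_lt a Aa.
suff /inf_lt : dist_set B a < eta.
  by case=> [|_ [b Bb <-] ab]; [exists `|a - b0|, b0 | exists b].
apply: le_lt_trans sup_lt; apply: ub_le_sup; last by exists a.
exists 1 => _ [c Ac <-]; apply: (@le_trans _ _ `|c - b0|).
  by apply: ge_inf; [exists 0 => _ [z _ <-] | exists b0].
move: (A01 c Ac) (B01 b0 Bb0); rewrite /= !in_itv /= => /andP[c0 c1] /andP[b0_ge0 b0_le1].
by rewrite ler_distl; lra.
Qed.

Lemma compl01_sub A : compl01 A `<=` `[0, 1].
Proof. by move=> x []. Qed.

Lemma compl01_nonempty A : A `<=` `]0, 1[ -> compl01 A !=set0.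
Proof.
move=> A01; exists 0; split; first by rewrite /= in_itv /= lexx ler01.
by move=> /A01; rewrite /= in_itv /= ltxx.
Qed.

Lemma near_set_compl01 eta A B : A `<=` `]0, 1[ -> B `<=` `]0, 1[ ->
  hausdorff (compl01 A) (compl01 B) < eta ->
  near_set eta (compl01 A) (compl01 B) /\ near_set eta (compl01 B) (compl01 A).
Proof.
move=> /compl01_nonempty A_nonempty /compl01_nonempty B_nonempty; rewrite gt_max => /andP[AB BA].
by split; apply: near_set_sup => //; exact: compl01_sub.
Qed.

Definition sign_region (n : nat) (e : seq bool) (b : bool) : set R :=
  interior (\bigcup_(s in [set s : nat | (1 <= s <= n.-1)%N /\ nth false e s.-1 = b]) @Iseg R n s).

Lemma UlamE n lam : is_comp n lam ->
  Ulam R lam = (sign_region n (comp_word lam) false, sign_region n (comp_word lam) true).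
Proof.
move=> cl; rewrite /Ulam; have -> : sumn lam = n by case/andP: cl => _ /eqP.
congr (interior _, interior _); congr bigcup => //;
  apply/seteqP; split => s /= []; rewrite (mem_Dcomp _ cl) => sn; rewrite sn;
  case/andP: sn => -> _ /=; by [move=> /negbTE -> | move=> ->].
Qed.

Lemma sign_region01 n e b : (1 < n)%N -> sign_region n e b `<=` `]0, 1[.
Proof.
move=> n1; rewrite -(@interior_itv_bnd _ 0 1 true false); apply: interiorS.
move=> x [s /= [/andP[s1 sn] _]]; rewrite /Iseg /= !in_itv /= => /andP[x1 x2].
have N0 : 0 < n.-1%:R :> R by rewrite ltr0n; lia.
by rewrite (le_trans _ x1) ?divr_ge0 //= (le_trans x2) // ler_pdivrMr // mul1r ler_nat.
Qed.

Lemma not_sign_region n e b x : (1 < n)%N -> compl01 (sign_region n e b) x ->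
  [\/ x * n.-1%:R <= 1, n.-1%:R - 1 <= x * n.-1%:R |
   exists i, [/\ (i < n.-1)%N, nth false e i = ~~ b & `|i%:R - x * n.-1%:R| <= 2]].
Proof.
move=> n1 [_ xI]; have N0 : 0 < n.-1%:R :> R by rewrite ltr0n; lia.
set N := n.-1 in N0 *.
have [x1|x1] := leP (x * N%:R) 1; first exact: Or31.
have [x2|x2] := leP (N%:R - 1) (x * N%:R); first exact: Or32.
apply: Or33; apply: contrapT => no_sign; apply: xI; apply/nbhs_ballP.
exists N%:R^-1; first by rewrite /= invr_gt0.
move=> y; rewrite /ball /= -(ltr_pM2r N0) mulVf ?gt_eqF // -(gtr0_norm N0) -normrM mulrBl.
rewrite ltr_distl => /andP[y1 y2]; have yN : 0 <= y * N%:R by lra.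
have /andP[i_le lt_i] := truncn_itv yN; set i := Num.truncn (y * N%:R) in i_le lt_i.
have iN : (i < N)%N by rewrite -(ltr_nat R); lra.
exists i.+1; last by rewrite /Iseg /= in_itv /= ler_pdivrMr // i_le /= ler_pdivlMr // ltW.
split => //=; apply: contrapT => ib; apply: no_sign; exists i; split => //.
  by case: b ib; case: nth.
by rewrite ler_distl; move: lt_i; rewrite -natr1; lra.
Qed.

Lemma midpoint_not_sign_region n e b i : (i < n.-1)%N -> nth false e i = ~~ b ->
  compl01 (sign_region n e b) ((i%:R + 2^-1) / n.-1%:R).
Proof.
move=> iN eb; set N := n.-1 in iN *.
have N0 : 0 < N%:R :> R by rewrite ltr0n; lia.
have i1 : i%:R + 1 <= N%:R :> R by rewrite natr1 ler_nat.
have i0 : 0 <= i%:R :> R by [].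
split; first by rewrite /= in_itv /= divr_ge0 ?ler_pdivrMr //; lra.
move=> /interior_subset[s /= [/andP[s1 sn] sb]]; rewrite /Iseg /= in_itv /= -/N.
rewrite !ler_pM2r ?invr_gt0 // => /andP[s_le le_s].
suff iE : s.-1 = i by move: sb; rewrite iE eb; case: b {eb}.
apply/eqP; rewrite eqn_leq -ltnS -(ltr_nat R) -natr1 -ltnS prednK // -(ltr_nat R).
by apply/andP; split; lra.
Qed.

Lemma run_sign n e b (U : set R) eta y z i : 0 <= y -> z <= 1 -> `]y, z[ `<=` U ->
  near_set eta (compl01 (sign_region n e b)) (compl01 U) ->
  (i < n.-1)%N -> y + eta <= (i%:R + 2^-1) / n.-1%:R <= z - eta -> nth false e i = b.
Proof.
move=> y0 z1 yzU nU iN /andP[lo hi]; apply: contrapT => ib.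
have eb : nth false e i = ~~ b by case: b ib {nU}; case: nth.
have [p [_ pU]] := nU _ (midpoint_not_sign_region iN eb); rewrite ltr_distl => /andP[? ?].
by apply: pU; apply: yzU; rewrite /= in_itv /=; apply/andP; split; lra.
Qed.

Lemma sign_change (e : nat -> bool) i j : e i != e j ->
  exists2 t, (minn i j <= t < maxn i j)%N & e t != e t.+1.
Proof.
have up i' j' : (i' < j')%N -> e i' != e j' -> exists2 t, (i' <= t < j')%N & e t != e t.+1.
  elim: j' => // j' IH; rewrite ltnS leq_eqVlt => /orP[/eqP ->|ij] eij.
    by exists j'; rewrite ?leqnn.
  have [E|E] := eqVneq (e j') (e j'.+1); last by exists j'; rewrite ?(ltnW ij) ?ltnSn.
  rewrite -E in eij; have [t /andP[it tj] et] := IH ij eij.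
  by exists t; rewrite // it leqW.
case: (ltngtP i j) => [ij|ji|->]; [exact: up | by rewrite eq_sym; exact: up | by rewrite eqxx].
Qed.

(* A point outside both sets is close to segments of both signs, hence to a sign change. *)
Lemma cut_point_near n e (Uu Ud : set R) eta x : (1 < n)%N -> 0 <= x <= 1 -> ~ Uu x -> ~ Ud x ->
  near_set eta (compl01 Uu) (compl01 (sign_region n e false)) ->
  near_set eta (compl01 Ud) (compl01 (sign_region n e true)) ->
  exists2 c, cut_point n e c & `|c%:R - x * n%:R| <= eta * n%:R + 4.
Proof.
move=> n1 x01 xu xd nearU nearD; have /andP[x_ge0 x_le1] := x01; set N : R := n.-1%:R.
have N0 : 0 < N by rewrite ltr0n; lia.
have nE : n%:R = N + 1 :> R by rewrite natr1 prednK // ltnW.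
have [xN_ge0 xN_le] : 0 <= x * N /\ x * N <= N by rewrite mulr_ge0 ?ler_piMl // ltW.
have [_ _ /(le_lt_trans (normr_ge0 _)) eta0] := nearU x (conj x01 xu).
have etaN0 : 0 < eta * N by rewrite mulr_gt0.
have near_sign b (U : set R) : ~ U x -> near_set eta (compl01 U) (compl01 (sign_region n e b)) ->
    (exists2 c, cut_point n e c & `|c%:R - x * n%:R| <= eta * n%:R + 4) \/
    exists i, [/\ (i < n.-1)%N, nth false e i = ~~ b & `|i%:R - x * N| <= eta * N + 2].
  move=> xU /(_ x (conj x01 xU))[z /(not_sign_region n1) z_cases].
  rewrite -(ltr_pM2r N0) -{1}(gtr0_norm N0) -normrM mulrBl ltr_distl => /andP[zlo zhi].
  move: z_cases; rewrite -/N => -[z1|z1|[i [iN ei iz]]].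
  - by left; exists 0%N; rewrite ?/cut_point ?eqxx // ler_distl nE; lra.
  - by left; exists n; rewrite ?/cut_point ?eqxx ?orbT // ler_distl nE; lra.
  by right; exists i; split => //; move: iz; rewrite !ler_distl; lra.
have [//|[i [iN ei ix]]] := near_sign false Uu xu nearU.
have [//|[j [jN ej jx]]] := near_sign true Ud xd nearD.
have [t /andP[tlo thi] et] := @sign_change (nth false e) i j (ltac:(by rewrite ei ej)).
have tn : (t.+2 < n)%N by rewrite -ltn_predRL (leq_ltn_trans thi) // gtn_max iN jN.
exists t.+2; first by rewrite /cut_point /= et tn !orbT.
have : `|t%:R - x * N| <= eta * N + 2.
  move: tlo (ltnW thi) ix jx; rewrite geq_min leq_max -!(ler_nat R) !ler_distl.
  by move=> /orP[] ? /orP[] ?; lra.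
by rewrite -!natr1 nE !ler_distl; lra.
Qed.

End HausdorffDistance.

(** * Subdivisions of the unit interval *)

Lemma open_disjoint_separated (T : topologicalType) (A B : set T) :
  open A -> open B -> A `&` B = set0 -> separated A B.
Proof.
have closure_disj (C D : set T) : open D -> C `&` D = set0 -> closure C `&` D = set0.
  move=> oD CD; rewrite -subset0 => x [clCx Dx].
  by have [y] := clCx D (open_nbhs_nbhs (conj oD Dx)); rewrite CD.
move=> oA oB AB; split; first exact: closure_disj.
by rewrite setIC; apply: closure_disj => //; rewrite setIC.
Qed.

Section Subdivision.
Variables (R : realType) (Uu Ud : set R).
Hypotheses (oUu : open Uu) (oUd : open Ud).
Hypotheses (Uu01 : Uu `<=` `]0, 1[) (Ud01 : Ud `<=` `]0, 1[) (UuUd : Uu `&` Ud = set0).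

Let K : set R := compl01 (Uu `|` Ud).

Definition gap (delta y z : R) : Prop :=
  y <= z /\ [\/ z - y <= delta, `]y, z[ `<=` Uu | `]y, z[ `<=` Ud].

Definition subdivision (delta : R) (N : nat) (x : nat -> R) (z : R) : Prop :=
  [/\ x 0%N = 0, x N = z, forall a, (a <= N)%N -> compl01 (Uu `|` Ud) (x a) &
      forall a, (a < N)%N -> gap delta (x a) (x a.+1)].

Lemma endpoints_outside : K 0 /\ K 1.
Proof.
by split; split => [|[/Uu01|/Ud01]]; rewrite /= in_itv /= ?ltxx ?andbF ?lexx ?ler01.
Qed.

Lemma subdivision_rcons delta N x y z : subdivision delta N x y -> K z -> gap delta y z ->
  subdivision delta N.+1 (fun a => if (a <= N)%N then x a else z) z.
Proof.
move=> [x0 xN xK xg] Kz gyz; split => [//||a _|a].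
- by rewrite ltnn.
- by case: ifP => // aN; exact: xK.
rewrite ltnS => aN; rewrite aN; case: ltngtP aN => // [aN|->] _; first exact: xg.
by rewrite xN.
Qed.

Lemma closed_outside : closed K.
Proof.
rewrite /K /compl01 setDE setCU; apply: closedI; first exact: interval_closed.
by apply: closedI; exact: open_closedC.
Qed.

Lemma outside_extrema (a b : R) : (`[a, b] `&` K) !=set0 ->
  (exists2 y, (`[a, b] `&` K) y & forall t, (`[a, b] `&` K) t -> t <= y) /\
  (exists2 y, (`[a, b] `&` K) y & forall t, (`[a, b] `&` K) t -> y <= t).
Proof.
move=> AK; have cA : compact (`[a, b] `&` K).
  apply: (subclosed_compact _ (@segment_compact _ a b)); last exact: subIsetl.
  by apply: closedI; [exact: interval_closed | exact: closed_outside].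
have ci : {within `[a, b] `&` K, continuous (fun t : R => t)}.
  by apply: continuous_subspaceT => t; exact: cvg_id.
have [[y /set_mem yK y_max] [z /set_mem zK z_min]] :=
  (compact_EVT_max AK cA ci, compact_EVT_min AK cA ci).
by split; [exists y | exists z] => // t /mem_set; [exact: y_max | exact: z_min].
Qed.

Lemma itv_in_component (y z : R) : 0 <= y -> z <= 1 -> (forall t, y < t < z -> ~ K t) ->
  `]y, z[ `<=` Uu \/ `]y, z[ `<=` Ud.
Proof.
move=> y0 z1 nK; apply: connected_subset (open_disjoint_separated oUu oUd UuUd) _ _.
  move=> t; rewrite /= in_itv /= => tyz; apply: contrapT => tU; apply: (nK t tyz).
  by split; rewrite //= in_itv /=; lra.
by apply/connected_intervalP; exact: interval_is_interval.
Qed.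

Lemma outside_around (a z : R) : 0 <= a <= z -> K z -> exists y u,
  [/\ K y, K u, 0 <= y <= a, a <= u <= z & `]y, u[ `<=` Uu \/ `]y, u[ `<=` Ud].
Proof.
move=> /andP[a0 az] Kz; have [K0 _] := endpoints_outside.
have [|[y [/= + Ky] y_max] _] := @outside_extrema 0 a.
  by exists 0; rewrite /= in_itv /= lexx.
have [|_ [u [/= + Ku] u_min]] := @outside_extrema a z.
  by exists z; rewrite /= in_itv /= lexx az.
have [/= + _] := Kz; rewrite !in_itv /= => /andP[_ z1] /andP[au uz] /andP[y0 ya].
exists y, u; split; rewrite ?y0 ?au //.
apply: itv_in_component => [//||t /andP[yt tu] Kt]; first exact: le_trans uz z1.
have [ta|/ltW at_] := leP t a.
  by have := y_max t; rewrite /= in_itv /= ta andbT => /(_ (conj _ Kt)); lra.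
by have := u_min t; rewrite /= in_itv /= at_ => /(_ (conj _ Kt)); lra.
Qed.

(* Jump back from [z] by about [delta], over the component that contains [z - delta], if any. *)
Lemma subdivision_exists (delta : R) : 0 < delta -> exists N x, subdivision delta N x 1.
Proof.
move=> d0; have [K0 K1] := endpoints_outside.
suff upto j z : K z -> z <= j%:R * delta -> exists N x, subdivision delta N x z.
  have /andP[_ /ltW] : _ := truncn_itv (ltW (etrans (invr_gt0 delta) d0)).
  by rewrite -(ler_pM2r d0) mulVf ?gt_eqF //; exact: upto.
elim: j z => [|j IH] z Kz zj; have [/= + _] := Kz; rewrite in_itv /= => /andP[z0 z1].
  exists 0%N, (fun=> 0); split => //; apply: le_anti; rewrite z0.
  by move: zj; rewrite mul0r.
pose a := Num.max 0 (z - delta).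
have a0z : 0 <= a <= z by rewrite /a le_max lexx ge_max z0 gerBl (ltW d0).
have aj : a <= j%:R * delta.
  by rewrite /a ge_max mulr_ge0 ?(ltW d0) //; move: zj; rewrite -natr1 mulrDl; lra.
have za : z - a <= delta by rewrite lerBlDl -lerBlDr /a le_max lexx orbT.
have [y [u [Ky Ku /andP[y0 ya] /andP[au uz] yuU]]] := outside_around a0z Kz.
have [N [x sx]] := IH y Ky (le_trans ya aj).
have gap_yu : gap delta y u.
  by split; [exact: le_trans au | case: yuU; [exact: Or32 | exact: Or33]].
have gap_uz : gap delta u z by split => //; apply: Or31; lra.
by exists N.+2; eexists; exact: subdivision_rcons (subdivision_rcons sx Ku gap_yu) Kz gap_uz.
Qed.

Section Cells.
Variables (delta : R) (N : nat) (x : nat -> R).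
Hypothesis sx : subdivision delta N x 1.

Lemma subdivision_le a b : (a <= b <= N)%N -> x a <= x b.
Proof.
case: sx => _ _ _ xg; elim: b => [|b IH]; first by rewrite leqn0 => /andP[/eqP ->].
move=> /andP[]; rewrite leq_eqVlt ltnS => /orP[/eqP -> //|ab] bN.
by apply: le_trans (xg b bN).1; apply: IH; rewrite ab ltnW.
Qed.

Lemma subdivision_outside a : (a <= N)%N -> [/\ 0 <= x a <= 1, ~ Uu (x a) & ~ Ud (x a)].
Proof.
case: sx => _ _ xK _ /xK[/= + xU]; rewrite in_itv /= => x01.
by split=> // xa; apply: xU; [left | right].
Qed.

Lemma subdivision01 a : (a <= N)%N -> 0 <= x a <= 1.
Proof. by case/subdivision_outside. Qed.

Lemma subdivision_cell_le (a : 'I_N) : x a <= x a.+1.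
Proof. by apply: subdivision_le; rewrite leqnSn ltn_ord. Qed.

Lemma subdivision_cells_le (a b : 'I_N) : (a < b)%N -> x a.+1 <= x b.
Proof. by move=> ab; apply: subdivision_le; rewrite ab ltnW. Qed.

Definition cell_of (t : R) : option 'I_N := [pick a : 'I_N | x a < t < x a.+1].

Definition cell_type (a : 'I_N) : option bool :=
  if `[< `]x a, x a.+1[ `<=` Uu >] then Some false
  else if `[< `]x a, x a.+1[ `<=` Ud >] then Some true else None.

Definition cell_length (a : option 'I_N) : R :=
  if a is Some b then x b.+1 - x b else 0.

Lemma cell_ofE t (a : 'I_N) : (cell_of t == Some a) = (x a < t < x a.+1).
Proof.
rewrite /cell_of; case: pickP => [b bt|none]; last by rewrite none.
apply/eqP/idP => [[<-] //|at_]; congr Some; apply/val_inj/eqP.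
by rewrite eqn_leq; apply/andP; split; rewrite leqNgt; apply/negP => /subdivision_cells_le; lra.
Qed.

Lemma cell_of_some t a : cell_of t = Some a -> x a < t < x a.+1.
Proof. by move/eqP; rewrite cell_ofE. Qed.

Lemma cell_of_none t : 0 <= t <= 1 -> cell_of t = None -> exists2 a, (a <= N)%N & t = x a.
Proof.
move=> /andP[t0 t1] tN; case: sx => x0 xN _ _; apply: contrapT => t_neq.
have lt_t b : (b <= N)%N -> x b < t.
  elim: b => [|b IH] bN; rewrite lt_neqAle.
    by rewrite x0 t0 andbT; apply/eqP => tx; apply: t_neq; exists 0%N; rewrite ?x0.
  apply/andP; split; first by apply/eqP => tx; apply: t_neq; exists b.+1.
  rewrite leNgt; apply/negP => tb; suff /eqP : cell_of t == Some (Ordinal bN) by rewrite tN.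
  by rewrite cell_ofE /= (IH (ltnW bN)).
by have := lt_t N (leqnn N); rewrite xN ltNge t1.
Qed.

Lemma distributions_cell_length k : distributions k (fun=> cell_length).
Proof.
move=> _ _; split=> [[a|] //=|]; first by rewrite subr_ge0 subdivision_cell_le.
rewrite (bigD1 None) //= add0r (reindex_omap Some id) /=; last by case.
rewrite (eq_bigl xpredT) => [|a]; last by rewrite eqxx.
case: sx => x0 xN _ _; transitivity (x N - x 0%N); last by rewrite xN x0 subr0.
by rewrite -(telescope_sumr x (leq0n N)) big_mkord.
Qed.

Lemma cell_type_none a : cell_type a = None -> cell_length (Some a) <= delta.
Proof.
rewrite /cell_type; case: asboolP => // nu; case: asboolP => // nd _.
by case: sx => _ _ _ /(_ a (ltn_ord a))[_ [//|/nu|/nd]].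
Qed.

Lemma samecomp_cell (U : set R) a t t' : `]x a, x a.+1[ `<=` U ->
  x a < t < x a.+1 -> x a < t' < x a.+1 -> samecomp U t t'.
Proof.
move=> aU ta ta'; split; first by apply: aU; rewrite /= in_itv.
exists `]x a, x a.+1[%classic; last by rewrite /= in_itv.
by split=> //; apply/connected_intervalP; exact: interval_is_interval.
Qed.

Lemma not_samecomp_between (U : set R) y t t' : ~ U y -> t < y < t' ->
  ~ samecomp U t t' /\ ~ samecomp U t' t.
Proof.
move=> yU /andP[ty yt']; have no (C : set R) : C t -> C t' -> C `<=` U -> connected C -> False.
  by move=> Ct Ct' CU /connected_intervalP cC; apply: yU; apply/CU/(cC t t') => //; rewrite !ltW.
by split=> -[_ [C [Ct CU cC] Ct']]; exact: (no C).
Qed.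

Definition paint_precedes (s : seq R) (i j : nat) : Prop :=
  let xi := nth 0 s i in let xj := nth 0 s j in
  (~ (samecomp Uu xi xj \/ samecomp Ud xi xj) /\ xi < xj) \/
  (samecomp Uu xi xj /\ (i < j)%N) \/ (samecomp Ud xi xj /\ (j < i)%N).

Lemma paint_precedes_cells (s : seq R) i j :
  resolved cell_type (map cell_of s) -> (i < size s)%N -> (j < size s)%N ->
  paint_precedes s i j <-> precedes cell_type (map cell_of s) i j.
Proof.
move=> res il jl; have cell_nth p a : (p < size s)%N ->
    nth None (map cell_of s) p = Some a -> x a < nth 0 s p < x a.+1.
  by move=> pl; rewrite (nth_map 0) //; exact: cell_of_some.
apply: (resolved_precedes (r := paint_precedes s)) => //; rewrite ?size_map //.
- by move=> p; rewrite /paint_precedes ltnn ltxx; case=> [[]|[[]|[]]].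
- move=> p q a b pl ql /(cell_nth p a pl) pa /(cell_nth q b ql) qb ab.
  have := subdivision_cells_le ab => x_ab.
  have [_ xU xD] := subdivision_outside (ltn_ord a).
  have between : nth 0 s p < x a.+1 < nth 0 s q by lra.
  have [pqU qpU] := not_samecomp_between xU between.
  have [pqD qpD] := not_samecomp_between xD between.
  split; first by left; split; [case|lra].
  by case=> [[_ ?]|[[]|[]]] //; lra.
move=> p q a d pl ql pq /(cell_nth p a pl) pa /(cell_nth q a ql) qa.
rewrite /paint_precedes /cell_type; case: asboolP => [aU [<-]|_].
  have same := samecomp_cell aU pa qa.
  have nd : ~ samecomp Ud (nth 0 s p) (nth 0 s q).
    by case=> td _; have : (Uu `&` Ud) (nth 0 s p) := conj same.1 td; rewrite UuUd.
  by split=> [|pq']; [case=> [[[]]|[[]|[/nd]]] //; left | right; left].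
case: asboolP => // aD [<-].
have same := samecomp_cell aD pa qa.
have nu : ~ samecomp Uu (nth 0 s p) (nth 0 s q).
  by case=> tu _; have : (Uu `&` Ud) (nth 0 s p) := conj tu same.1; rewrite UuUd.
by split=> [|pq']; [case=> [[[]]|[[/nu]|[]]] //; right | right; right].
Qed.

Lemma index_pword k (s : 'S_k) (i : 'I_k) : index (val i) (pword s) = (s^-1)%g i.
Proof.
rewrite /pword -{1}(permKV s i) (map_comp val) index_map; last exact: val_inj.
by rewrite index_map ?index_enum_ord //; exact: perm_inj.
Qed.

Lemma paint_event_cells k (s : 'S_k) (t : seq R) :
  size t = k -> resolved cell_type (map cell_of t) ->
  paint_event Uu Ud s t <-> realizes cell_type (pword s) (map cell_of t).
Proof.
move=> tk res; have sk : size (pword s) = k by rewrite size_map size_enum_ord.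
have cells i j : (i < k)%N -> (j < k)%N ->
    paint_precedes t i j <-> precedes cell_type (map cell_of t) i j.
  by rewrite -tk => ik jk; exact: paint_precedes_cells.
split=> [ev|/realizesP re i j].
  apply/realizesP => i j; rewrite sk => ik jk; have := ev (Ordinal ik) (Ordinal jk).
  rewrite -!index_pword /= => ev_ij.
  by apply/idP/idP => [/ev_ij/(cells _ _ ik jk)|/(cells _ _ ik jk)/ev_ij].
rewrite /= -!index_pword re ?sk ?ltn_ord //.
exact: iff_sym (cells i j (ltn_ord i) (ltn_ord j)).
Qed.

End Cells.
End Subdivision.

(** * Iterated integrals of step functions *)

(* The integral of a nonnegative function is a supremum over simple functions below
   it, so this needs no measurability. *)
Lemma ge0_le_integral_nomeas d (T : measurableType d) (R : realType)
    (mu : {measure set T -> \bar R}) (D : set T) (f g : T -> \bar R) :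
  (forall t, D t -> 0 <= f t)%E -> (forall t, D t -> f t <= g t)%E ->
  (\int[mu]_(t in D) f t <= \int[mu]_(t in D) g t)%E.
Proof.
move=> f0 fg; have g0 t : D t -> (0 <= g t)%E by move=> Dt; apply: le_trans (fg t Dt); exact: f0.
rewrite !ge0_integralE //; apply: ereal_sup_le => _ [h hf <-]; exists h => // t.
apply: (le_trans (hf t)); rewrite /patch; case: ifP => // tD.
by apply: fg; exact: set_mem.
Qed.

Section StepIntegral.
Variables (R : realType) (C : finType) (cell : R -> C) (l : C -> R).
Hypothesis measurable_cell :
  forall a, measurable (cell @^-1` [set a] : set (measurableTypeR R)).
Hypothesis lebesgue_cell : forall a,
  lebesgue_measure (cell @^-1` [set a] `&` `[(0%R:R), 1%R]) = (l a)%:E.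

Lemma cell_weight_ge0 a : 0 <= l a.
Proof. by rewrite -lee_fin -lebesgue_cell. Qed.

Lemma integral_cells (g : C -> R) : (forall a, 0 <= g a) ->
  (\int[lebesgue_measure]_(t in `[(0%R:R), 1%R]) (g (cell t))%:E = (\sum_a l a * g a)%:E)%E.
Proof.
move=> g0.
have step t : ((g (cell t))%:E =
    \sum_(a <- index_enum C) ((g a)%:E * (\1_(cell @^-1` [set a]) t)%:E))%E.
  rewrite (bigD1_seq (cell t)) ?index_enum_uniq ?mem_index_enum //=.
  rewrite big1 ?adde0 => [|a aN]; first by rewrite indicE mem_set // mule1.
  by rewrite indicE memNset ?mule0 //= => aE; rewrite -aE eqxx in aN.
have meas_indic a :
    measurable_fun `[(0%R:R), 1%R] (fun t => (\1_(cell @^-1` [set a]) t)%:E : \bar R).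
  by apply/measurable_EFinP; apply: measurable_indic; exact: measurable_cell.
under eq_integral do rewrite step.
rewrite ge0_integral_sum //; first last.
- by move=> a t _; rewrite mule_ge0 ?lee_fin.
- by move=> a; apply: measurable_funeM; exact: meas_indic.
rewrite -sumEFin; apply: eq_bigr => a _.
rewrite ge0_integralZl_EFin //; last exact: meas_indic.
by rewrite integral_indic // mulrC EFinM; congr (_ * _)%E; exact: lebesgue_cell.
Qed.

Lemma expect_cells_ge0 k (h : seq C -> R) : (forall s, 0 <= h s) -> 0 <= expect k (fun=> l) h.
Proof.
elim: k h => //= k IH h h0; apply: sumr_ge0 => a _.
by rewrite mulr_ge0 ?cell_weight_ge0 // IH.
Qed.

Lemma expect_le_iter_int01 k (f : seq R -> \bar R) (h : seq C -> R) :
  (forall s, 0 <= h s) -> (forall s, size s = k -> (h (map cell s))%:E <= f s)%E ->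
  ((expect k (fun=> l) h)%:E <= iter_int01 k f)%E.
Proof.
elim: k f h => [|k IH] f h h0 hf /=; first exact: hf.
rewrite -(@integral_cells (fun a => expect k (fun=> l) (fun s => h (a :: s)))); last first.
  by move=> a; apply: expect_cells_ge0.
apply: ge0_le_integral_nomeas => t _; first by rewrite lee_fin expect_cells_ge0.
by apply: IH => // s sk; apply: (hf (t :: s)); rewrite /= sk.
Qed.

Lemma iter_int01_ge0 k (f : seq R -> \bar R) : (forall s, 0 <= f s)%E -> (0 <= iter_int01 k f)%E.
Proof. by elim: k f => //= k IH f f0; apply: integral_ge0 => t _; exact: IH. Qed.

Lemma iter_int01_le_expect k (f : seq R -> \bar R) (h : seq C -> R) :
  (forall s, 0 <= h s) -> (forall s, 0 <= f s)%E ->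
  (forall s, size s = k -> f s <= (h (map cell s))%:E)%E ->
  (iter_int01 k f <= (expect k (fun=> l) h)%:E)%E.
Proof.
elim: k f h => [|k IH] f h h0 f0 fh /=; first exact: fh.
rewrite -(@integral_cells (fun a => expect k (fun=> l) (fun s => h (a :: s)))); last first.
  by move=> a; apply: expect_cells_ge0.
apply: ge0_le_integral_nomeas => t _; first exact: iter_int01_ge0.
by apply: IH => // s sk; apply: (fh (t :: s)); rewrite /= sk.
Qed.

End StepIntegral.

Section PaintProbBounds.
Variables (R : realType) (Uu Ud : set R) (delta : R) (N : nat) (x : nat -> R).
Hypothesis UuUd : Uu `&` Ud = set0.
Hypothesis sx : subdivision Uu Ud delta N x 1.

Lemma cell_of_preimage (a : 'I_N) : cell_of N x @^-1` [set Some a] = `]x a, x a.+1[%classic.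
Proof.
apply/seteqP; split => t /=; rewrite in_itv /=; first exact: (cell_of_some sx).
by rewrite -(cell_ofE sx) => /eqP.
Qed.

Lemma measurable_cell_of a : measurable (cell_of N x @^-1` [set a] : set (measurableTypeR R)).
Proof.
case: a => [a|]; first by rewrite cell_of_preimage; exact: measurable_itv.
have -> : cell_of N x @^-1` [set None] = ~` \bigcup_(a in [set: 'I_N]) `]x a, x a.+1[%classic.
  apply/seteqP; split => t /=.
    by move=> tN [a _]; rewrite -cell_of_preimage /= tN.
  move=> no_cell; case tE : (cell_of N x t) => [a|] //; exfalso; apply: no_cell; exists a => //.
  by rewrite -cell_of_preimage.
by apply: measurableC; apply: fin_bigcup_measurable => // a _; exact: measurable_itv.
Qed.

Lemma lebesgue_cell_of a :
  lebesgue_measure (cell_of N x @^-1` [set a] `&` `[(0%R:R), 1%R]) = (cell_length x a)%:E.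
Proof.
case: a => [a|] /=.
  have -> : cell_of N x @^-1` [set Some a] `&` `[(0%R:R), 1%R] = `]x a, x a.+1[%classic.
    rewrite cell_of_preimage; apply/setIidPl => t /=; rewrite !in_itv /=.
    have := subdivision01 sx (ltn_ord a); have := subdivision01 sx (ltnW (ltn_ord a)); lra.
  rewrite lebesgue_measure_itv /= lte_fin lt_neqAle (subdivision_cell_le sx) andbT.
  by case: (eqVneq (x a) (x a.+1)) => [->|]; rewrite ?subrr.
apply: countable_lebesgue_measure0; apply: (@sub_countable _ _ _ (x @` `I_N.+1)).
  apply: subset_card_le => t [/= tN]; rewrite in_itv /= => t01.
  by have [a aN ->] := cell_of_none sx t01 tN; exists a.
by apply: finite_set_countable; apply: finite_image; exact: finite_II.
Qed.

Lemma paint_prob_bounds k (s : 'S_k) :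
  expect k (fun=> @cell_length R N x)
    (fun al => (surely_realizes (cell_type Uu Ud x) (pword s) al)%:R) <=
  paint_prob Uu Ud s <=
  expect k (fun=> @cell_length R N x)
    (fun al => (possibly_realizes (cell_type Uu Ud x) (pword s) al)%:R).
Proof.
set surely := expect _ _ _; set possibly := expect _ _ _.
set f : seq R -> \bar R := fun t => (\1_(paint_event Uu Ud s) t)%:E.
have lower : (surely%:E <= iter_int01 k f)%E.
  apply: (expect_le_iter_int01 measurable_cell_of lebesgue_cell_of) => [//|t tk].
  rewrite lee_fin indicE ler_nat /surely_realizes; case: (boolP (resolved _ _)) => //= res.
  case: (boolP (realizes _ _ _)) => // /(paint_event_cells UuUd sx s tk res).2 ev.
  by rewrite mem_set.
have upper : (iter_int01 k f <= possibly%:E)%E.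
  apply: (iter_int01_le_expect measurable_cell_of lebesgue_cell_of) => [//|t|t tk].
    by rewrite lee_fin indicE.
  rewrite lee_fin indicE ler_nat /possibly_realizes; case: (boolP (resolved _ _)) => /= [res|_].
    by case: (boolP (t \in _)) => // /set_mem/(paint_event_cells UuUd sx s tk res).1 ->.
  by rewrite leq_b1.
rewrite /paint_prob -/f; case: (iter_int01 k f) lower upper => [r| |] //=.
by rewrite !lee_fin => -> ->.
Qed.

End PaintProbBounds.

(** * Martin kernel *)

Lemma pword_perms k (s : 'S_k) : pword s \in perms k.
Proof.
rewrite mem_permutations; apply: uniq_perm; rewrite ?iota_uniq //.
  by rewrite map_inj_uniq ?enum_uniq // => i j /val_inj; exact: perm_inj.
move=> i; rewrite mem_iota add0n; apply/mapP/idP => [[j _ ->]|ik]; first exact: ltn_ord.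
by exists ((s^-1)%g (Ordinal ik)); rewrite ?mem_enum // permKV.
Qed.

Lemma descents_pword mu (s : 'S_(sumn mu)) : is_comp (sumn mu) mu ->
  pdes s =i Dcomp mu -> descents (pword s) = comp_word mu.
Proof.
move=> cm ps; apply/eqP/(eq_descentsP (perms_size (pword_perms s)) (size_comp_word cm)) => i ik.
have := ps i.+1; rewrite (mem_Dcomp _ cm) /= => <-.
by rewrite mem_filter mem_iota /= add1n ltnS ltn_predRL ik andbT.
Qed.

Lemma descents_mapS w : descents (map S w) = descents w.
Proof. by case: w => [|a r] //=; elim: r a => [|b r IH] a //=; rewrite IH ltnS. Qed.

Lemma exists_descents e : exists2 w, w \in perms (size e).+1 & descents w = e.
Proof.
elim: e => [|b e [w wP wE]]; first by exists [:: 0%N]; rewrite ?mem_permutations.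
have w0 : w != [::] by rewrite -size_eq0 (perms_size wP).
move: (wP); rewrite mem_permutations => w_iota; case: b.
  exists ((size e).+1 :: w).
    rewrite mem_permutations perm_sym -[(size (true :: e)).+1]addn1 iotaD perm_catC /= add0n.
    by rewrite perm_cons perm_sym.
  case: w w0 wP wE {w_iota} => // a r _ wP wE; rewrite -[RHS]/(true :: e) -[in RHS]wE /=.
  by rewrite -(perms_mem a wP) mem_head.
exists (0%N :: map S w); last first.
  by rewrite -[in RHS]wE -[in RHS]descents_mapS; case: w w0 {wP wE w_iota}.
rewrite mem_permutations -[iota 0 _]/(0%N :: iota 1 (size e).+1) perm_cons (iotaDl 1 0).
exact: perm_map.
Qed.

Lemma size_descent_class_gt0 n e : (0 < n)%N -> size e = n.-1 -> (0 < size (descent_class n e))%N.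
Proof.
move=> n0 se; have [w + wE] := exists_descents e; rewrite se prednK // => wP.
have : w \in descent_class n e by rewrite mem_descent_class wP wE eqxx.
by case: (descent_class n e).
Qed.

Lemma martinKE (R : realType) n mu lam sg : is_comp (sumn mu) mu -> is_comp n lam ->
  (sumn mu <= n)%N -> sg \in perms (sumn mu) -> descents sg = comp_word mu ->
  martinK mu lam =
  proportion R (has_pattern sg (iota 0 (sumn mu))) (descent_class n (comp_word lam)).
Proof.
move=> cm cl kn sgP sgE; have sl : sumn lam = n by case/andP: cl => _ /eqP.
rewrite /martinK /dZ sl /= subn0 proportionE.
rewrite (npaths_count (k := sumn mu) cm sgP sgE) ?subnK //.
rewrite (npaths_count (k := 0) (mu := [::]) (sg := [::])) ?addn0 //.
rewrite -(count_predT (descent_class n _)); congr (_%:R / _%:R); apply: eq_count => w.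
  rewrite /has_pattern (_ : [seq nth _ _ i | i <- sg] = sg); last first.
    by apply: map_id_in => i; rewrite (perms_mem _ sgP) => ik; rewrite nth_iota.
  by congr (_ == _); apply: eq_filter => y; rewrite mem_iota.
by rewrite (eq_filter (a2 := pred0)) ?filter_pred0.
Qed.

(** * Cells of positions *)

Lemma count_near (R : realType) (X Y : R) n : 0 <= Y ->
  (count (fun p : nat => `|p%:R - X| < Y) (iota 0 n))%:R <= 2 * Y + 2 :> R.
Proof.
move=> Y0; have /andP[] := truncn_itv (mulr_ge0 (ler0n R 2) Y0).
have := truncnS_gt (X - Y); set t := Num.truncn _; set r := Num.truncn _ => lt_t r_le lt_r.
apply: (@le_trans _ _ r.+2%:R); last by rewrite -[r.+2%:R]natr1 -[r.+1%:R]natr1; lra.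
rewrite ler_nat -size_filter -(size_iota t r.+2).
apply: uniq_leq_size => [|p]; first by rewrite filter_uniq // iota_uniq.
rewrite mem_filter ltr_distl !mem_iota => /andP[/andP[lo hi] _].
rewrite [(t <= p)%N]truncn_le_nat -(ltr_nat R) natrD -[r.+2%:R]natr1 -[p.+1%:R]natr1.
by rewrite -[t.+1%:R]natr1 in lt_t; apply/andP; split; lra.
Qed.

Section PositionCells.
Variables (R : realType) (Uu Ud : set R) (delta : R) (N : nat) (x : nat -> R).
Hypothesis sx : subdivision Uu Ud delta N x 1.
Variables (n : nat) (e : seq bool) (eta : R).
Hypotheses (n1 : (1 < n)%N) (eta0 : 0 < eta) (eta1 : eta <= 1) (etan : 100 <= eta * n.-1%:R).
Hypotheses
  (nearU : near_set eta (compl01 Uu) (compl01 (sign_region n e false)))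
  (nearU' : near_set eta (compl01 (sign_region n e false)) (compl01 Uu))
  (nearD : near_set eta (compl01 Ud) (compl01 (sign_region n e true)))
  (nearD' : near_set eta (compl01 (sign_region n e true)) (compl01 Ud)).

Let n_pred_gt0 : 0 < n.-1%:R :> R.
Proof. by rewrite ltr0n; lia. Qed.

Let natr_pred : n%:R = n.-1%:R + 1 :> R.
Proof. by rewrite natr1 prednK // ltnW. Qed.

Definition pos (p : nat) : R := p%:R / n.-1%:R.

Lemma posE p : p%:R = pos p * n.-1%:R.
Proof. by rewrite /pos divfK // gt_eqF. Qed.

Lemma pos01 p : (p < n)%N -> 0 <= pos p <= 1.
Proof.
move=> pn; rewrite /pos divr_ge0 ?(ltW n_pred_gt0) //= ler_pdivrMr // mul1r ler_nat.
by rewrite -ltnS prednK // ltnW.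
Qed.

(* The margin around the points [x a] absorbs the discretization errors. *)
Definition position_cell (p : nat) : option 'I_N :=
  if [exists a : 'I_N.+1, `|pos p - x a| < 3 * eta] then None else cell_of N x (pos p).

Lemma position_cellE p : position_cell p != None -> position_cell p = cell_of N x (pos p).
Proof. by rewrite /position_cell; case: ifP. Qed.

Lemma position_cell_far p a : position_cell p != None -> (a <= N)%N ->
  pos p <= x a - 3 * eta \/ x a + 3 * eta <= pos p.
Proof.
rewrite /position_cell; case: existsP => // none _ aN.
have : ~~ (`|pos p - x a| < 3 * eta).
  by apply/negP => near_a; apply: none; exists (Ordinal (aN : (a < N.+1)%N)).
by rewrite -leNgt ler_normr => /orP[far|far]; [right|left]; lra.
Qed.

Lemma position_cell_some p a : position_cell p = Some a ->
  x a + 3 * eta <= pos p <= x a.+1 - 3 * eta.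
Proof.
move=> pE; have pN : position_cell p != None by rewrite pE.
have : x a < pos p < x a.+1 by apply: (cell_of_some sx); rewrite -position_cellE.
have := position_cell_far pN (ltn_ord a); have := position_cell_far pN (ltnW (ltn_ord a)).
by case=> ?; case=> ?; lra.
Qed.

Lemma position_cell_lt p p' (a b : 'I_N) :
  position_cell p = Some a -> position_cell p' = Some b -> (a < b)%N -> (p < p')%N.
Proof.
move=> /position_cell_some pa /position_cell_some pb /(subdivision_cells_le sx) ab.
have pp' : pos p < pos p' by have := eta0; lra.
by rewrite -(ltr_nat R) (posE p) (posE p') ltr_pM2r.
Qed.

Lemma position_cell_run p p' a d i : (p <= i < p')%N -> (p' < n)%N ->
  position_cell p = Some a -> position_cell p' = Some a ->
  cell_type Uu Ud x a = Some d -> nth false e i = d.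
Proof.
move=> /andP[pi ip] pn /position_cell_some pa /position_cell_some pa' aE.
have iN : (i < n.-1)%N by rewrite ltn_predRL; exact: leq_ltn_trans ip pn.
have /andP[x0 _] := subdivision01 sx (ltnW (ltn_ord a)).
have /andP[_ x1] := subdivision01 sx (ltn_ord a).
have mid : x a + eta <= (i%:R + 2^-1) / n.-1%:R <= x a.+1 - eta.
  have : pos p <= (i%:R + 2^-1) / n.-1%:R.
    by rewrite ler_pM2r ?invr_gt0 //; move: pi; rewrite -(ler_nat R); lra.
  have : (i%:R + 2^-1) / n.-1%:R <= pos p'.
    by rewrite ler_pM2r ?invr_gt0 //; move: ip; rewrite -(ler_nat R) -natr1; lra.
  by have := eta0; lra.
move: aE; rewrite /cell_type; case: asboolP => [aU [<-]|_]; first exact: run_sign aU nearU' iN mid.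
by case: asboolP => // aD [<-]; exact: run_sign aD nearD' iN mid.
Qed.

Lemma cut_points : exists c : nat -> nat, forall a, (a <= N)%N ->
  cut_point n e (c a) /\ `|(c a)%:R - x a * n%:R| <= eta * n%:R + 4.
Proof.
suff cut_near a : exists c, (a <= N)%N ->
    cut_point n e c /\ `|c%:R - x a * n%:R| <= eta * n%:R + 4.
  by have [c cP] := choice cut_near; exists c.
have [aN|aN] := leqP a N; last by exists 0%N.
have [x01 xu xd] := subdivision_outside sx aN.
by have [c ec cx] := cut_point_near n1 x01 xu xd nearU nearD; exists c.
Qed.

Lemma position_cell_cut (c : nat -> nat) p (a : 'I_N) :
  (forall b, (b <= N)%N -> `|(c b)%:R - x b * n%:R| <= eta * n%:R + 4) ->
  position_cell p != None -> ((position_cell p == Some a) + (p < c a) = (p < c a.+1))%N.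
Proof.
move=> cx pN; have [e0 e1 en] := And3 eta0 eta1 etan.
have side b : (b <= N)%N -> (p < c b)%N = (pos p < x b).
  move=> bN; have := cx b bN; rewrite ler_distl natr_pred => /andP[lo hi].
  have /andP[xb0 xb1] := subdivision01 sx bN; rewrite -(ltr_nat R) posE.
  by case: (position_cell_far pN bN) => far; have := far; rewrite -(ler_pM2r n_pred_gt0) => farN;
    apply/idP/idP; lra.
rewrite position_cellE // (cell_ofE sx) !side ?ltn_ord //; last exact: ltnW.
have := subdivision_cell_le sx a; have := position_cell_far pN (ltnW (ltn_ord a)).
case: (ltgtP (pos p) (x a)) => [lt_a| |->] far le_a /=; first by rewrite (lt_le_trans lt_a).
  by rewrite addn0.
by exfalso; case: far; lra.
Qed.

Lemma count_no_cell :
  (count (fun p => position_cell p == None) (iota 0 n))%:R <= N.+1%:R * (7 * eta * n%:R) :> R.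
Proof.
have [e0 e1 en] := And3 eta0 eta1 etan.
have union : (count (fun p => position_cell p == None) (iota 0 n) <=
    \sum_(a < N.+1)
      count (fun p : nat => (`|p%:R - x a * n.-1%:R| < 3 * eta * n.-1%:R)%R) (iota 0 n))%N.
  under eq_bigr do rewrite -sum1_count big_mkcond.
  rewrite exchange_big /= -sum1_count big_mkcond big_seq [leqRHS]big_seq.
  apply: leq_sum => p; rewrite mem_iota add0n => pn; case: ifP => // /eqP pE.
  have [a pa] : exists a : 'I_N.+1, `|pos p - x a| < 3 * eta.
    move: pE; rewrite /position_cell; case: existsP => // none pN.
    have [a aN pa] := cell_of_none sx (pos01 pn) pN.
    by exists (Ordinal (aN : (a < N.+1)%N)); rewrite /= pa subrr normr0; lra.
  by rewrite (bigD1 a) //= (posE p) -mulrBl normrM (gtr0_norm n_pred_gt0) ltr_pM2r // pa addn_gt0.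
move: union; rewrite -(ler_nat R) => /le_trans; apply; rewrite natr_sum.
apply: (@le_trans _ _ (\sum_(a < N.+1) 7 * eta * n%:R)).
  apply: ler_sum => a _; apply: (le_trans (count_near _ _ _)); first by rewrite !mulr_ge0 //; lra.
  by rewrite natr_pred; lra.
by rewrite sumr_const card_ord -[leLHS]mulr_natl.
Qed.

Variables (k : nat) (sg : seq nat).
Hypotheses (kn : (k < n)%N) (se : size e = n.-1) (sgP : sg \in perms k).

Let m := (n %/ k.+1)%N.

Let m_gt0 : (0 < m)%N.
Proof. by rewrite divn_gt0. Qed.

Let km_le : (k * m <= n)%N.
Proof. by apply: leq_trans (leq_divM n k.+1); rewrite mulnC leq_mul2l leqnSn orbT. Qed.

Lemma block_count_le : n%:R / m%:R <= (2 * k.+1)%:R :> R.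
Proof.
rewrite ler_pdivrMr ?ltr0n // -natrM ler_nat.
have := ltn_ceil n (ltn0Sn k); rewrite -/m => /ltnW/leq_trans; apply.
by rewrite mulnAC leq_mul2r; have := m_gt0; lia.
Qed.

Definition mesh_constant : R := (4 + 7 * N.+1%:R) * (2 * k.+1)%:R + 3.

Lemma position_freq_close (c : nat -> nat) w i a :
  (forall b, (b <= N)%N -> `|(c b)%:R - x b * n%:R| <= eta * n%:R + 4) ->
  w \in descent_class n e -> (i < k)%N -> ~~ some_unbalanced m N c k eta w ->
  `|block_freq R n m position_cell w i a - cell_length x a| <= mesh_constant * eta.
Proof.
move=> cx wE ik balanced; have [e0 e1 en] := And3 eta0 eta1 etan.
have n_gt0 : 0 < n%:R :> R by rewrite ltr0n ltnW.
have length_close (b : 'I_N) :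
    `|((c b.+1)%:R - (c b)%:R) / n%:R - cell_length x (Some b)| <= 3 * eta.
  have := cx _ (ltn_ord b); have := cx _ (ltnW (ltn_ord b)).
  rewrite !ler_distl ler_pdivlMr // ler_pdivrMr // natr_pred /= => /andP[? ?] /andP[? ?].
  by apply/andP; split; lra.
have cut p b (_ : (p < n)%N) := @position_cell_cut c p b cx.
have eta3 : 0 <= 3 * eta by rewrite mulr_ge0 // ltW.
have := block_freq_close (l := cell_length x) cut a m_gt0 km_le wE ik count_no_cell (erefl _)
  length_close eta3 (ltW eta0) balanced.
move=> /le_trans; apply.
rewrite /mesh_constant [leRHS]mulrDl lerD2r.
rewrite (_ : _ / _ = (4 + 7 * N.+1%:R) * eta * (n%:R / m%:R)); last first.
  by field; rewrite pnatr_eq0 -lt0n.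
by rewrite [leRHS]mulrAC ler_wpM2l ?block_count_le // mulr_ge0 // ltW.
Qed.

Lemma pattern_proportion_bounds t : t%:R <= eta * n%:R ->
  let err := k%:R * N.+1%:R * (mesh_constant * eta) +
    N.+1%:R * k%:R * (n%:R * n.+1%:R * (1 - eta) ^+ t) in
  expect k (fun=> @cell_length R N x)
    (fun al => (surely_realizes (cell_type Uu Ud x) sg al)%:R) - err <=
  proportion R (has_pattern sg (iota 0 k)) (descent_class n e) <=
  expect k (fun=> @cell_length R N x)
    (fun al => (possibly_realizes (cell_type Uu Ud x) sg al)%:R) + err.
Proof.
move=> tn /=; have [c cP] := cut_points.
have cx b : (b <= N)%N -> `|(c b)%:R - x b * n%:R| <= eta * n%:R + 4 by move=> /cP[].
have eta01 : 0 < eta <= 1 by rewrite eta0.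
have n_gt0 : (0 < n)%N by exact: ltnW.
have := @proportion_some_unbalanced R n m N c k e eta t n_gt0 se eta01 tn (fun b bN => (cP b bN).1).
have mesh_ge0 : 0 <= mesh_constant * eta by rewrite mulr_ge0 ?(ltW eta0) // addr_ge0 // mulr_ge0.
have := pattern_proportion_sandwich m_gt0 km_le sgP se
  (fun p p' a b _ _ => @position_cell_lt p p' a b) position_cell_run
  (distributions_cell_length sx (k := k)) mesh_ge0 (size_descent_class_gt0 n_gt0 se)
  (fun w i a wE bal ik => position_freq_close a cx wE ik bal).
lra.
Qed.

End PositionCells.

(** * Convergence *)

Lemma pow_decay (R : realType) (eta : R) t j : 0 <= eta <= 1 ->
  (1 - eta) ^+ t * (t%:R * eta) ^+ j.+1 <= (j.+1)`!%:R.
Proof.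
move=> /andP[eta0 eta1]; have te : 0 <= t%:R * eta by rewrite mulr_ge0.
have : (1 - eta) ^+ t <= (expR (t%:R * eta))^-1.
  by rewrite -expRN -mulrN expRM_natl lerXn2r ?nnegrE ?expR_ge0 ?subr_ge0 // expR_ge1Dx.
move=> decay; apply: le_trans (ler_wpM2r (exprn_ge0 j.+1 te) decay) _.
rewrite ler_pdivrMl ?expR_gt0 // -ler_pdivrMr ?ltr0n ?fact_gt0 //.
by apply: le_trans (expR_ge1Dxn j te); rewrite lerDr.
Qed.

Lemma square_pow_cvg0 (R : realType) (eta : R) : 0 < eta <= 1 ->
  (fun n : nat => n%:R * n.+1%:R * (1 - eta) ^+ Num.truncn (eta * n%:R)) @ \oo --> (0 : R).
Proof.
move=> /andP[eta0 eta1]; apply/cvgrPdist_le => eps eps0; pose q := eta ^+ 2 / 2.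
have q0 : 0 < q by rewrite divr_gt0 ?exprn_gt0.
near=> n; rewrite sub0r normrN ger0_norm ?mulr_ge0 ?exprn_ge0 ?subr_ge0 //.
have n1 : 1 <= n%:R :> R by near: n; exact: nbhs_infty_ger.
have two_le : 2 <= eta * n%:R by rewrite -ler_pdivrMl //; near: n; exact: nbhs_infty_ger.
have twelve_le : 12 <= eps * q ^+ 3 * n%:R.
  by rewrite -ler_pdivrMl ?mulr_gt0 ?exprn_gt0 //; near: n; exact: nbhs_infty_ger.
set t := Num.truncn _; have t_ge : eta * n%:R / 2 <= t%:R.
  by have := truncnS_gt (eta * n%:R); rewrite -/t -natr1; lra.
have decay : (1 - eta) ^+ t * (q * n%:R) ^+ 3 <= 6.
  have eta01 : 0 <= eta <= 1 by rewrite ltW.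
  apply: le_trans (pow_decay t 2 eta01 : _ <= 6).
  rewrite ler_wpM2l ?exprn_ge0 ?subr_ge0 // lerXn2r ?nnegrE ?mulr_ge0 ?(ltW q0) ?(ltW eta0) //.
  by have := ler_wpM2r (ltW eta0) t_ge; rewrite /q expr2; lra.
have qn : 0 < (q * n%:R) ^+ 3 by rewrite exprn_gt0 // mulr_gt0 //; lra.
rewrite -(ler_pM2r qn) -[leLHS]mulrA.
apply: (@le_trans _ _ (n%:R * (2 * n%:R) * 6)).
  apply: (ler_pM _ _ _ decay); first by rewrite mulr_ge0.
    by rewrite mulr_ge0 ?(ltW qn) // exprn_ge0 // subr_ge0.
  by rewrite ler_wpM2l // -natr1; lra.
rewrite (_ : eps * _ = n%:R ^+ 2 * (eps * q ^+ 3 * n%:R)); last by ring.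
by have := ler_wpM2l (sqr_ge0 n%:R) twelve_le; rewrite expr2; lra.
Unshelve. all: by end_near.
Qed.

Lemma ler_mul_of_div_succ (R : realFieldType) (M b c : R) :
  0 <= M -> 0 <= b -> c <= b / (M + 1) -> M * c <= b.
Proof.
move=> M0 b0; rewrite ler_pdivlMr ?ltr_wpDl // => c_le.
by have [c0|/ltW c0] := leP 0 c; [lra | rewrite (le_trans _ b0) // mulr_ge0_le0].
Qed.

Section PatternLimit.
Variables (R : realType) (Uu Ud : set R).
Hypotheses (oUu : open Uu) (oUd : open Ud).
Hypotheses (Uu01 : Uu `<=` `]0, 1[) (Ud01 : Ud `<=` `]0, 1[) (UuUd : Uu `&` Ud = set0).

Lemma pattern_proportion_near k (s : 'S_k) (eps : R) : 0 < eps ->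
  \forall eta \near 0^'+, \forall n \near \oo, forall e, size e = n.-1 ->
    dU2 (sign_region n e false, sign_region n e true) (Uu, Ud) < eta ->
    `|proportion R (has_pattern (pword s) (iota 0 k)) (descent_class n e) - paint_prob Uu Ud s|
      <= eps.
Proof.
move=> eps0; have [eps2 eps4] : 0 < eps / 2 /\ 0 < eps / 4 by rewrite !divr_gt0.
pose delta := eps / 2 / (k%:R ^+ 2 + 1).
have k2 : 0 <= k%:R ^+ 2 :> R by rewrite exprn_ge0.
have delta0 : 0 < delta by rewrite divr_gt0 ?ltr_wpDl.
have k_delta := ler_mul_of_div_succ k2 (ltW eps2) (lexx delta).
have [N [x sx]] := subdivision_exists oUu oUd Uu01 Ud01 UuUd delta0.
have paint := paint_prob_bounds UuUd sx s.
have possibly_le := expect_possibly_le (pword s) (distributions_cell_length sx (k := k)) erefl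
  (ltW delta0) (cell_type_none sx).
pose M : R := k%:R * N.+1%:R * mesh_constant R N k; pose W : R := N.+1%:R * k%:R.
have M0 : 0 <= M by rewrite !mulr_ge0 // addr_ge0 // !mulr_ge0 // addr_ge0 // mulr_ge0.
have W0 : 0 <= W by rewrite mulr_ge0.
near=> eta.
have eta0 : 0 < eta by [].
have eta1 : eta <= 1 by near: eta; exact: nbhs_right_le.
have M_eta : M * eta <= eps / 4.
  apply: ler_mul_of_div_succ => //; first exact: ltW.
  by near: eta; apply: nbhs_right_le; rewrite divr_gt0 ?ltr_wpDl.
have eta01 : 0 < eta <= 1 by rewrite eta0.
have W_level : 0 < eps / 4 / (W + 1) by rewrite divr_gt0 ?ltr_wpDl.
have decay := cvgr_le _ (square_pow_cvg0 eta01) _ W_level.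
near=> n => e se close.
have n1 : (1 < n)%N by near: n; exact: nbhs_infty_ge.
have kn : (k < n)%N by near: n; exact: nbhs_infty_ge.
have etan : 100 <= eta * n.-1%:R.
  have : 101 <= eta * n%:R by rewrite -ler_pdivrMl //; near: n; exact: nbhs_infty_ger.
  by rewrite -(prednK (ltnW n1)) -natr1; lra.
have W_decay : W * (n%:R * n.+1%:R * (1 - eta) ^+ Num.truncn (eta * n%:R)) <= eps / 4.
  by apply: ler_mul_of_div_succ => //; [exact: ltW | near: n; exact: decay].
move: close; rewrite /dU2 gt_max /= => /andP[closeU closeD].
have [nearU' nearU] := near_set_compl01 (@sign_region01 R n e false n1) Uu01 closeU.
have [nearD' nearD] := near_set_compl01 (@sign_region01 R n e true n1) Ud01 closeD.
have tn : (Num.truncn (eta * n%:R))%:R <= eta * n%:R by rewrite truncn_le mulr_ge0 // ltW.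
have := pattern_proportion_bounds sx n1 eta0 eta1 etan nearU nearU' nearD nearD' kn se
  (pword_perms s) tn.
move: paint possibly_le; rewrite /= (mulrA _ _ eta) -/M -/W ler_distl; lra.
Unshelve. all: by end_near.
Qed.

End PatternLimit.

Theorem theorem8 (R : realType) (lam : nat -> seq nat) (Uu Ud : set R) :
  (forall n : nat, (2 <= n)%N -> is_comp n (lam n)) ->
  open Uu -> open Ud ->
  Uu `<=` `]0, 1[ -> Ud `<=` `]0, 1[ -> Uu `&` Ud = set0 ->
  (fun n : nat => dU2 (Ulam R (lam n)) (Uu, Ud)) @ \oo --> (0 : R) ->
  forall mu : seq nat, is_comp (sumn mu) mu ->
  forall s : 'S_(sumn mu), pdes s =i Dcomp mu ->
  (fun n : nat => martinK (R := R) mu (lam n)) @ \oo --> paint_prob Uu Ud s.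
Proof.
move=> lamP oU oD U01 D01 UD cv mu cm s ps; apply/cvgrPdist_le => eps eps0.
near (0 : R)^'+ => eta.
have pattern_close : \forall n \near \oo, forall e, size e = n.-1 ->
    dU2 (sign_region n e false, sign_region n e true) (Uu, Ud) < eta ->
    `|proportion R (has_pattern (pword s) (iota 0 (sumn mu))) (descent_class n e) -
      paint_prob Uu Ud s| <= eps.
  by near: eta; exact: pattern_proportion_near.
have U_close : \forall n \near \oo, dU2 (Ulam R (lam n)) (Uu, Ud) < eta by exact: cvgr_lt cv _ _.
near=> n; have n2 : (2 <= n)%N by near: n; exact: nbhs_infty_ge.
have mu_le : (sumn mu <= n)%N by near: n; exact: nbhs_infty_ge.
have cl := lamP n n2.
rewrite distrC (martinKE R cm cl mu_le (pword_perms s) (descents_pword cm ps)).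
apply: (near pattern_close n) => //; first exact: size_comp_word cl.
by rewrite -(UlamE R cl); near: n; exact: U_close.
Unshelve. all: by end_near.
Qed.
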